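(* Let $(H_s)_{s\in\mathbb{R}}$ be a smoothness scale, let $S>0$, and let $(V_j)_{j\in\mathbb{N}}$ and $\delta(j,s)$ ($j\in\mathbb N$, $s\in(0,S)$) be linear subspaces and approximation numbers satisfying the approximation assumption (all as defined in the context). Let $G$ be a separable Hilbert space with norm $\|\cdot\|$, and let $A:H_0\to G$ be a bounded linear operator such that, for some $\gamma\in(0,S)$, $\|Af\|\simeq\|f\|_{-\gamma}$ for all $f\in H_0$. For $f\in H_0$ let $f^{(j)}\in V_j$ denote the Galerkin solution to $Af$ relative to $V_j$. Let $f_0\in H_\beta$ for some $\beta\in(0,S)$. Let $\eta_n\ge\varepsilon_n\downarrow0$ be sequences with $n\varepsilon_n^2\to\infty$, let $j_n\in\mathbb{N}$ with $j_n\to\infty$, let $c>0$, and assume that $$j_n\le c\,n\varepsilon_n^2,\qquad \eta_n\ge\frac{\varepsilon_n}{\delta(j_n,\gamma)},\qquad \eta_n\ge\delta(j_n,\beta).$$ Let $\Pi$ (possibly depending on $n$) be Borel probability distributions on $H_0$ satisfying $$\Pi\bigl(f:\|Af-Af_0\|<\varepsilon_n\bigr)\ge e^{-n\varepsilon_n^2},\qquad \Pi\bigl(f:\|f^{(j_n)}-f\|_0>\eta_n\bigr)\le e^{-4n\varepsilon_n^2}.$$ Then the posterior distribution $\Pi_n(\cdot\mid Y^{(n)})$ based on the prior $\Pi$ in the white noise inverse problem contracts at rate $\eta_n$ at $f_0$: for a sufficiently large constant $M$, $$\Pi_n\bigl(f:\|f-f_0\|_0>M\eta_n\mid Y^{(n)}\bigr)\to0$$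 in probability as $n\to\infty$, under the law of $Y^{(n)}$ with $f=f_0$.
   Context: Notation: $\lesssim,\gtrsim,\simeq$ mean $\le,\ge,=$ up to positive multiplicative constants (for $\simeq$: two-sided bounds) that do not depend on $n$, $j$ or the functions involved. Smoothness scale: a family $(H_s)_{s\in\mathbb{R}}$ of infinite-dimensional separable Hilbert spaces with inner products $\langle\cdot,\cdot\rangle_s$ and norms $\|\cdot\|_s$ such that (i) for $s<t$ the space $H_t$ is a dense subspace of $H_s$ and $\|f\|_s\lesssim\|f\|_t$ for $f\in H_t$; (ii) for $s\ge0$ and $f\in H_0$ (viewed as an element of $H_{-s}\supset H_0$), $\|f\|_{-s}=\sup_{\|g\|_s\le1}\langle f,g\rangle_0$. Approximation assumption: for every $j\in\mathbb{N}$ there is a $(j-1)$-dimensional linear subspace $V_j\subset H_0$ (the same for all $s$), and for every $s\in(0,S)$ a number $\delta(j,s)>0$ with $\delta(j,s)\to0$ as $j\to\infty$, such that $\inf_{g\in V_j}\|f-g\|_0\lesssim\delta(j,s)\|f\|_s$ for all $f\in H_s$, and $\|g\|_s\lesssim\delta(j,s)^{-1}\|g\|_0$ for all $g\in V_j$. Galerkin solution: with $W_j=AV_j\subset G$ and $Q_j:G\to W_j$ the orthogonal projection, $f^{(j)}$ is the unique element of $V_j$ with $Af^{(j)}=Q_jAf$. Model: given $f\in H_0$, the observation is the stochastic process $Y^{(n)}=(Y^{(n)}(w):w\in G)$, $Y^{(n)}(w)=\langle Af,w\rangle_G+n^{-1/2}\xi(w)$, where $\xi$ is a zero-mean Gaussian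 process indexed by $G$ with covariance $\mathbb{E}\,\xi(w_1)\xi(w_2)=\langle w_1,w_2\rangle_G$; $Y^{(n)}$ is a random element of $\mathbb{R}^G$ with the product $\sigma$-field (equivalently, one observes the sequence $Y^{(n)}(w_i)$ for an orthonormal basis $(w_i)$ of $G$). Let $p_f^{(n)}$ be the density of the law of $Y^{(n)}$ under $f$ relative to the law under $f=0$, chosen jointly measurable. The posterior for prior $\Pi$ is $\Pi_n(B\mid Y^{(n)})=\int_Bp_f^{(n)}(Y^{(n)})\,d\Pi(f)\big/\int p_f^{(n)}(Y^{(n)})\,d\Pi(f)$ for Borel sets $B\subset H_0$. *)

(* Defs.v *)
From HB Require Import structures.
From mathcomp Require Import all_boot all_order all_algebra.
From mathcomp Require Import all_classical all_reals all_analysis.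

Set Implicit Arguments.
Unset Strict Implicit.
Unset Printing Implicit Defensive.

Import Order.TTheory GRing.Theory Num.Theory.
Import numFieldNormedType.Exports.

Local Open Scope classical_set_scope.
Local Open Scope ring_scope.

(* Real Hilbert spaces: Banach spaces whose norm comes from an inner product. *)
HB.mixin Record NormedModule_isHilbert (R : realType) V
    of CompleteNormedModule R V := {
  inner : V -> V -> R ;
  innerC : forall x y, inner x y = inner y x ;
  innerDl : forall x y z, inner (x + y) z = inner x z + inner y z ;
  innerZl : forall a x y, inner (a *: x) y = a * inner x y ;
  inner_norm : forall x, inner x x = `|x| ^+ 2
}.

#[short(type="hilbertType")]
HB.structure Definition Hilbert (R : realType) :=
  {V of NormedModule_isHilbert R V & CompleteNormedModule R V}.

Definition separable (T : topologicalType) :=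
  exists D : set T, countable D /\ dense D.

Section linear_algebra.
Variables (R : realType) (E : lmodType R).

Definition lin_indep (n : nat) (b : 'I_n -> E) :=
  forall a : 'I_n -> R, \sum_i a i *: b i = 0 -> forall i, a i = 0.

Definition infinite_dim := forall n, exists b : 'I_n -> E, lin_indep b.

Definition subspace_of_dim (n : nat) (V : set E) :=
  exists b : 'I_n -> E, lin_indep b /\
    V = [set x | exists a : 'I_n -> R, x = \sum_i a i *: b i].

End linear_algebra.

(* The inclusion of H_t in H_s (s <= t) is the injective linear map           *)
(* [@scale_incl H s t], which is unconstrained when t < s. The multiplicative *)
(* constant in [incl_bounded] may depend on s and t.                          *)
Record smoothness_scale (R : realType) := SmoothnessScale {
  scale_space : R -> hilbertType R ;
  scale_incl : forall s t : R, scale_space t -> scale_space s ;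
  scale_separable : forall s, separable (scale_space s) ;
  scale_infinite_dim : forall s, infinite_dim (scale_space s) ;
  incl_linear : forall s t, s <= t -> linear (@scale_incl s t) ;
  incl_inj : forall s t, s <= t -> injective (@scale_incl s t) ;
  incl_id : forall s (f : scale_space s), scale_incl s f = f ;
  incl_comp : forall r s t (f : scale_space t), r <= s -> s <= t ->
    scale_incl r (scale_incl s f) = scale_incl r f ;
  incl_dense : forall s t, s < t -> dense (range (@scale_incl s t)) ;
  incl_bounded : forall s t, s < t ->
    exists2 C : R, 0 < C & forall f : scale_space t,
      `|scale_incl s f| <= C * `|f| ;
  scale_dual : forall s (f : scale_space 0), 0 <= s ->
    `|scale_incl (- s) f| =
      sup [set inner f (scale_incl 0 g) |
             g in [set g : scale_space s | `|g| <= 1]]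
}.
Coercion scale_space : smoothness_scale >-> Funclass.

(* Indices j start at 1. The constants may depend on s but not on j. The last *)
(* clause includes the fact that V_j is contained in H_s for 0 < s < S.       *)
Definition approximation_assumption (R : realType) (H : smoothness_scale R)
    (S : R) (V : nat -> set (H 0)) (delta : nat -> R -> R) :=
  (forall j, (0 < j)%N -> subspace_of_dim j.-1 (V j)) /\
  forall s, 0 < s -> s < S ->
  [/\ forall j, (0 < j)%N -> 0 < delta j s,
      delta j s @[j --> \oo] --> 0,
      exists2 C : R, 0 < C & forall j, (0 < j)%N -> forall f : H s,
        inf [set `|scale_incl 0 f - g| | g in V j] <= C * (delta j s * `|f|) &
      exists2 C : R, 0 < C & forall j, (0 < j)%N -> forall g, V j g ->
        exists2 g' : H s, scale_incl 0 g' = g &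
          `|g'| <= C * ((delta j s)^-1 * `|g|)].

Section galerkin.
Variables (R : realType) (E G : hilbertType R).

(* The orthogonal projection of x on W, when it exists (e.g. for a            *)
(* finite-dimensional subspace W).                                            *)
Definition orth_proj (W : set G) (x : G) : G :=
  xget 0 [set y | W y /\ forall w, W w -> inner (x - y) w = 0].

Definition galerkin (A : E -> G) (V : set E) (f : E) : E :=
  xget 0 [set g | V g /\ A g = orth_proj (A @` V) (A f)].

End galerkin.

Notation borel T := (g_sigma_algebraType (@open T)).

Definition cylinders (R : realType) (I : Type) : set (set (I -> R)) :=
  [set C | exists (i : I) (B : set R), measurable B /\ C = [set y | B (y i)]].

(* R^I with the product sigma-field *)
Notation path_space R I := (g_sigma_algebraType (@cylinders R I)).

(* The library's [normal_prob m 0] is not the Dirac mass at m. *)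
Definition gaussian_law (R : realType) (m s : R) (B : set R) : \bar R :=
  if s == 0 then dirac m B else normal_prob m s B.

Section white_noise.
Context (R : realType) (d : measure_display) (Omega : measurableType d).
Variables (P : probability Omega R) (G : hilbertType R).

Definition gaussian_process (I : Type) (X : I -> {RV P >-> R}) :=
  forall (k : nat) (i : 'I_k -> I) (a : 'I_k -> R), exists m s : R,
  forall B : set R, measurable B ->
    P [set o | B (\sum_(l < k) a l * X (i l) o)] = gaussian_law m s B.

Definition white_noise (xi : G -> {RV P >-> R}) :=
  [/\ gaussian_process xi,
      forall w, ('E_P[xi w] = 0)%E &
      forall w1 w2,
        ('E_P[(fun o => xi w1 o * xi w2 o)%R] = (inner w1 w2)%:E)%E].

Definition observation (xi : G -> {RV P >-> R}) (n : nat) (g : G)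
    (o : Omega) : path_space R G :=
  fun w => inner g w + (Num.sqrt n%:R)^-1 * xi w o.

Variables (E : hilbertType R) (A : E -> G) (xi : G -> {RV P >-> R}).

Definition obs_law (n : nat) (f : E) : set (path_space R G) -> \bar R :=
  pushforward P (observation xi n (A f)).

Definition is_likelihood (n : nat) (p : E -> (G -> R) -> R) :=
  [/\ forall f y, 0 <= p f y,
      measurable_fun [set: borel E * path_space R G]
        (fun fy => p fy.1 fy.2) &
      forall f (B : set (path_space R G)), measurable B ->
        obs_law n f B = (\int[obs_law n 0%R]_(y in B) (p f y)%:E)%E].

Definition posterior (Pi : probability (borel E) R) (p : E -> (G -> R) -> R)
    (y : G -> R) (B : set E) : \bar R :=
  ((\int[Pi]_(f in B) (p f y)%:E) / (\int[Pi]_f (p f y)%:E))%E.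

End white_noise.

(* Main.v *)
(** Write [s = n ε_n²]. Everything is a bound on the law of the data under [f0].

    Denominator: by the Cameron-Martin formula the law under [f0] has density
    [L_f = exp (ξ h - ‖h‖²/2)], [h = √n A(f0 - f)], with respect to the law under
    [f]. So, up to a null set, [p_f < 2a p_f0] forces [L_f > 1/(4a)], an event of
    probability at most [4a exp (n ‖A(f - f0)‖²)]. With [a = exp (- 2s)], averaging
    over the prior ball [‖A(f - f0)‖ < ε_n] shows that the denominator exceeds
    [exp (- 3s) p_f0] outside an event of probability [8 exp (- s)].

    Numerator: Markov's inequality and Tonelli's theorem reduce it to a prior mass
    bound (functions with a large Galerkin error) and to a test, which accepts when
    the projection of the data on [A V_j] is close to that of [A f0]. Both error
    probabilities are chi-square tails with fewer than [j_n <= c s] degrees of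
    freedom: if [f] has a small Galerkin error and is accepted under moderate noise,
    then stability of the Galerkin scheme and duality give [‖f - f0‖₀ <= M η_n].

    The Cameron-Martin formula is extended step by step: from exponentials of
    coordinates to polynomials (differentiating), to sines (dominated convergence of
    the power series), to indicators of half-spaces (iterating a smooth-step
    polynomial) and to all measurable sets. *)

Require Import Defs.
From HB Require Import structures.
From mathcomp Require Import all_boot all_order all_algebra.
From mathcomp Require Import all_classical all_reals all_analysis.
From mathcomp Require Import measurable_realfun ring lra.

Import Order.TTheory GRing.Theory Num.Theory.
Import numFieldNormedType.Exports.

Local Open Scope classical_set_scope.
Local Open Scope ring_scope.

Set Implicit Arguments.
Unset Strict Implicit.
Unset Printing Implicit Defensive.

(** * Integration *)

Section comparison_measurability.
Context d (T : measurableType d) (R : realType).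
Implicit Types f g : T -> R.

Lemma measurable_set_ltr f g : measurable_fun setT f -> measurable_fun setT g ->
  measurable [set t | f t < g t].
Proof.
move=> mf mg; rewrite (_ : [set t | _] = setT `&` [set t | ((f t)%:E < (g t)%:E)%E]).
  by apply: measurable_lte => //; exact/measurable_EFinP.
by rewrite setTI; apply/seteqP; split => t /=; rewrite lte_fin.
Qed.

Lemma measurable_set_ler f g : measurable_fun setT f -> measurable_fun setT g ->
  measurable [set t | f t <= g t].
Proof.
move=> mf mg; rewrite (_ : [set t | _] = setT `&` [set t | ((f t)%:E <= (g t)%:E)%E]).
  by apply: measurable_lee => //; exact/measurable_EFinP.
by rewrite setTI; apply/seteqP; split => t /=; rewrite lee_fin.
Qed.

End comparison_measurability.

(** * Real-valued integrals as a relation *)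

Section has_integral.
Context d (T : measurableType d) (R : realType) (mu : {measure set T -> \bar R}).
Implicit Types (f g : T -> R) (x y : R).

(** Integrability and the value are kept together, with real rather than extended real values, so
    that identities between integrals can be added, scaled and passed to the limit without side
    conditions. *)
Definition has_integral f x :=
  mu.-integrable setT (EFin \o f) /\ (\int[mu]_t (f t)%:E = x%:E)%E.

Lemma has_integral_measurable f x : has_integral f x -> measurable_fun setT f.
Proof. by move=> [/measurable_int/measurable_EFinP]. Qed.

Lemma has_integral_unique f x y : has_integral f x -> has_integral f y -> x = y.
Proof. by move=> [_ fx] [_]; rewrite fx => -[]. Qed.

Lemma integrable_has_integral f : mu.-integrable setT (EFin \o f) ->
  exists x, has_integral f x.
Proof.
move=> fi; exists (fine (\int[mu]_t (f t)%:E)); split => //.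
by rewrite fineK//; exact: integrable_fin_num.
Qed.

Lemma ge0_has_integral f x : measurable_fun setT f -> (forall t, 0 <= f t) ->
  (\int[mu]_t (f t)%:E = x%:E)%E -> has_integral f x.
Proof.
move=> mf f0 fx; split => //; apply/integrableP; split.
  exact/measurable_EFinP.
under eq_integral do rewrite /= ger0_norm//.
by rewrite fx ltry.
Qed.

Lemma has_integralD f g x y : has_integral f x -> has_integral g y ->
  has_integral (fun t => f t + g t) (x + y).
Proof.
move=> [fi fx] [gi gy]; split.
  by have := integrableD measurableT fi gi.
under eq_integral do rewrite EFinD.
by rewrite integralD// fx gy.
Qed.

Lemma has_integralZ a f x : has_integral f x ->
  has_integral (fun t => a * f t) (a * x).
Proof.
move=> [fi fx]; split.
  by have := integrableZl measurableT a fi.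
under eq_integral do rewrite EFinM.
by rewrite integralZl// fx.
Qed.

Lemma has_integralB f g x y : has_integral f x -> has_integral g y ->
  has_integral (fun t => f t - g t) (x - y).
Proof.
move=> fx /(has_integralZ (-1)) /(has_integralD fx).
rewrite mulN1r; under [X in has_integral X]eq_fun do rewrite mulN1r.
by [].
Qed.

Lemma has_integral_ae f g x : measurable_fun setT g ->
  {ae mu, forall t, f t = g t} -> has_integral f x -> has_integral g x.
Proof.
move=> mg fg [fi fx]; have mf : measurable_fun setT f.
  by move/measurable_int/measurable_EFinP : fi.
have fge : ae_eq mu setT (EFin \o f) (EFin \o g).
  by apply: filterS fg => t /= -> _.
split; last first.
  by rewrite -fx; apply/esym; apply: ae_eq_integral => //; exact/measurable_EFinP.
apply/integrableP; split; first exact/measurable_EFinP.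
move/integrableP : fi => [_]; congr (_ < _)%E.
apply: ae_eq_integral => //.
- by apply: measurableT_comp => //; exact/measurable_EFinP.
- by apply: measurableT_comp => //; exact/measurable_EFinP.
- by apply: filterS fge => t /= + _ => /(_ I) [->].
Qed.

Lemma le_has_integral f g x y : (forall t, f t <= g t) ->
  has_integral f x -> has_integral g y -> x <= y.
Proof.
move=> fg [fi fx] [gi gy]; rewrite -lee_fin -fx -gy.
by apply: le_integral => // t _; rewrite lee_fin.
Qed.

Lemma dominated_has_integral f g y : measurable_fun setT f ->
  (forall t, `|f t| <= g t) -> has_integral g y -> exists x, has_integral f x.
Proof.
move=> mf fg [gi _]; apply: integrable_has_integral.
apply: le_integrable gi => //; first exact/measurable_EFinP.
by move=> t _ /=; rewrite lee_fin (le_trans (fg t))// ler_norm.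
Qed.

(** Dominated convergence. The value of the limit integral is produced as a limit of [x_], so two
    integrals with the same approximating values can be identified by uniqueness of limits. *)
Lemma has_integral_cvg (f_ : nat -> T -> R) (x_ : nat -> R) f g y :
  (forall n, has_integral (f_ n) (x_ n)) ->
  (forall t, f_ n t @[n --> \oo] --> f t) ->
  (forall n t, `|f_ n t| <= g t) -> has_integral g y ->
  exists2 x, has_integral f x & x_ n @[n --> \oo] --> x.
Proof.
move=> fx ff fg [gi gy].
have mf_ n := has_integral_measurable (fx n).
have mf : measurable_fun setT f.
  by apply: (@measurable_fun_cvg _ _ _ _ f_ f mf_) => t _; exact: ff.
have [||||fi _ fcvg] := @dominated_convergence _ _ _ mu setT measurableT
    (fun n => EFin \o f_ n) (EFin \o f) (EFin \o g) _ _ _ gi _.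
- by move=> n; exact/measurable_EFinP.
- exact/measurable_EFinP.
- by apply: aeW => t _; apply/fine_cvgP; split; [exact: nearW|exact: ff].
- by apply: aeW => t n _ /=; rewrite lee_fin.
have [x hx] := integrable_has_integral fi.
exists x => //; move: fcvg.
under eq_fun do rewrite (fx _).2.
by case: hx => _ -> /fine_cvgP[].
Qed.

Lemma has_integral0_ae f : (forall t, 0 <= f t) -> has_integral f 0 ->
  {ae mu, forall t, f t = 0}.
Proof.
move=> f0 [fi f00].
have /ae_eq_integral_abs : measurable_fun setT (EFin \o f).
  exact: measurable_int fi.
move=> /(_ mu measurableT)[+ _].
have -> : (\int[mu]_x `|(EFin \o f) x| = 0)%E.
  by rewrite -[RHS]f00; apply: eq_integral => t _; rewrite /= ger0_norm.
by move=> /(_ erefl); apply: filterS => t /(_ I) [].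
Qed.

End has_integral.

(** * Difference quotients of the exponential *)

Section exponential_bounds.
Context {R : realType}.
Implicit Types (x u : R).

Lemma expRB1_le u : `|expR u - 1| <= `|u| * expR `|u|.
Proof.
have e1 := expR_ge1Dx u; have e2 := expR_ge1Dx (- u).
have e0 := expR_gt0 u.
have ee : expR (- u) * expR u = 1 by rewrite -expRD addNr expR0.
have [u0|u0] := leP 0 u.
  rewrite (ger0_norm u0) ger0_norm; last by rewrite subr_ge0; lra.
  nra.
have E := expR_ge1Dx `|u|.
rewrite ler0_norm; first by rewrite ltr0_norm// in E *; nra.
have : expR u <= 1 by rewrite -[leRHS]expR0 ler_expR ltW.
lra.
Qed.

(** The remainder is nonnegative by the tangent bound and at most [u * (expR u - 1)], because (1 -
    u) e^u <= 1. *)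
Lemma expR_taylor1 u : `|expR u - 1 - u| <= u ^+ 2 * expR `|u|.
Proof.
have e1 := expR_ge1Dx u; have e2 := expR_ge1Dx (- u).
have e0 := expR_gt0 u.
have ee : expR (- u) * expR u = 1 by rewrite -expRD addNr expR0.
rewrite ger0_norm; last by lra.
have h : expR u - 1 - u <= u * (expR u - 1) by nra.
rewrite (le_trans h)// (le_trans (ler_norm _))// normrM -real_normK ?num_real//.
by rewrite expr2 -mulrA ler_wpM2l// expRB1_le.
Qed.

Lemma cvg_expR_diff (h : nat -> R) x : h n @[n --> \oo] --> 0 ->
  (forall n, 0 < h n <= 1) ->
  (expR (h n * x) - 1) / h n @[n --> \oo] --> x.
Proof.
move=> h0 hP; apply/cvgrPdist_le => e e0.
have c1 : 0 < x ^+ 2 * expR `|x| + 1.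
  by rewrite ltr_wpDl// pmulr_lge0 ?expR_gt0// sqr_ge0.
near=> n.
have /andP[hn hn1] := hP n.
have -> : x - (expR (h n * x) - 1) / h n =
    - (expR (h n * x) - 1 - h n * x) / h n by field; rewrite gt_eqF.
rewrite normrM normrN normfV (gtr0_norm hn) ler_pdivrMr//.
rewrite (le_trans (expR_taylor1 _))// exprMn normrM (gtr0_norm hn).
have : expR (h n * `|x|) <= expR `|x| by rewrite ler_expR ler_piMl.
have hh : h n <= e / (x ^+ 2 * expR `|x| + 1).
  near: n; have /cvgrPdist_le := h0.
  have c0 : 0 < e / (x ^+ 2 * expR `|x| + 1).
    by rewrite divr_gt0.
  move=> /(_ _ c0); apply: filterS => k.
  by rewrite sub0r normrN; apply: le_trans; rewrite ler_norm.
move=> ex; rewrite [leRHS]mulrC.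
rewrite (_ : _ * expR _ = h n * (h n * (x ^+ 2 * expR (h n * `|x|)))); last by ring.
rewrite ler_pM2l//.
move: hh; rewrite ler_pdivlMr//.
have := sqr_ge0 x; have := expR_ge0 `|x|.
move=> E0 x2 hh; apply: le_trans hh.
rewrite ler_pM2l//; apply: le_trans (_ : x ^+ 2 * expR `|x| <= _); last by lra.
by rewrite ler_wpM2l.
Unshelve. all: by end_near. Qed.

Lemma expR_normr_le x : expR `|x| <= expR x + expR (- x).
Proof.
have [x0|x0] := leP 0 x; first by rewrite ger0_norm// lerDl expR_ge0.
by rewrite ltr0_norm// lerDr expR_ge0.
Qed.

Lemma normr_le_expR x : `|x| <= expR `|x|.
Proof. by rewrite (le_trans _ (expR_ge1Dx _))// lerDr. Qed.

(** Domination uniform in [h], by exponentials that are integrable under Gaussian noise: |x| e^{|x|}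
    <= e^{2|x|}. *)
Lemma expR_diff_bound (h : R) x : 0 < h <= 1 ->
  `|(expR (h * x) - 1) / h| <= expR (2 * x) + expR (- (2 * x)).
Proof.
move=> /andP[h0 h1]; rewrite normrM normfV (gtr0_norm h0) ler_pdivrMr//.
rewrite (le_trans (expRB1_le _))// normrM (gtr0_norm h0).
have : expR (h * `|x|) <= expR `|x| by rewrite ler_expR ler_piMl.
have := normr_le_expR x; have := expR_normr_le (2 * x).
have -> : expR `|2 * x| = expR `|x| * expR `|x|.
  by rewrite -expRD normrM ger0_norm// mulrDl mul1r.
have := normr_ge0 x; have := expR_gt0 `|x|; have := expR_gt0 (h * `|x|).
move=> a0 b0 x0 e1 e2 e3.
rewrite [leRHS]mulrC -mulrA ler_pM2l//; apply: le_trans e1.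
by rewrite ler_pM// ltW.
Qed.

End exponential_bounds.

(** * Hilbert spaces and Galerkin projections *)

Section hilbert_space.
Context {R : realType} {E : hilbertType R}.
Implicit Types (x y z : E) (a : R).

Lemma innerDr x y z : inner x (y + z) = inner x y + inner x z.
Proof. by rewrite innerC innerDl !(innerC x). Qed.

Lemma innerZr a x y : inner x (a *: y) = a * inner x y.
Proof. by rewrite innerC innerZl innerC. Qed.

Lemma inner0l x : inner 0 x = 0.
Proof. by rewrite -[X in inner X _](scale0r 0) innerZl mul0r. Qed.

Lemma inner0r x : inner x 0 = 0.
Proof. by rewrite innerC inner0l. Qed.

Lemma innerNl x y : inner (- x) y = - inner x y.
Proof. by rewrite -scaleN1r innerZl mulN1r. Qed.

Lemma innerNr x y : inner x (- y) = - inner x y.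
Proof. by rewrite innerC innerNl innerC. Qed.

Lemma innerBl x y z : inner (x - y) z = inner x z - inner y z.
Proof. by rewrite innerDl innerNl. Qed.

Lemma innerBr x y z : inner x (y - z) = inner x y - inner x z.
Proof. by rewrite innerDr innerNr. Qed.

Lemma inner_suml (I : Type) (r : seq I) (P : pred I) (F : I -> E) y :
  inner (\sum_(i <- r | P i) F i) y = \sum_(i <- r | P i) inner (F i) y.
Proof.
elim/big_rec2 : _ => [|i u v _ <-]; first by rewrite inner0l.
by rewrite innerDl.
Qed.

Lemma inner_sumr (I : Type) (r : seq I) (P : pred I) (F : I -> E) y :
  inner y (\sum_(i <- r | P i) F i) = \sum_(i <- r | P i) inner y (F i).
Proof. by rewrite innerC inner_suml; apply: eq_bigr => i _; rewrite innerC. Qed.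

Lemma normDsqr x y : `|x + y| ^+ 2 = `|x| ^+ 2 + 2 * inner x y + `|y| ^+ 2.
Proof. by rewrite -!inner_norm innerDl !innerDr (innerC y x); ring. Qed.

Lemma Cauchy_Schwarz_inner x y : inner x y <= `|x| * `|y|.
Proof.
have [->|x0] := eqVneq x 0; first by rewrite inner0l normr0 mul0r.
have [->|y0] := eqVneq y 0; first by rewrite inner0r normr0 mulr0.
have xy0 : 0 < `|x| * `|y| by rewrite mulr_gt0 ?normr_gt0.
have := sqr_ge0 `|(`|y| *: x) + - (`|x| *: y)|.
rewrite normDsqr normrN !normrZ !normr_id innerNr innerZl innerZr => h.
rewrite -(ler_pM2l xy0); nra.
Qed.

Lemma Cauchy_Schwarz_norm x y : `|inner x y| <= `|x| * `|y|.
Proof.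
rewrite ler_norml Cauchy_Schwarz_inner andbT lerNl -innerNl.
by rewrite -(normrN x) Cauchy_Schwarz_inner.
Qed.

Lemma continuous_innerl y : continuous (fun x => inner x y).
Proof.
move=> x; apply/cvgrPdist_le => e e0.
near=> z; rewrite -innerBl (le_trans (Cauchy_Schwarz_norm _ _))//.
rewrite (@le_trans _ _ (`|x - z| * (`|y| + 1)))//.
  by rewrite ler_wpM2l// lerDl.
rewrite -ler_pdivlMr ?ltr_wpDl//; near: z.
by apply: cvgr_dist_le => //; rewrite divr_gt0// ltr_wpDl.
Unshelve. all: by end_near. Qed.

End hilbert_space.

(** * Gram-Schmidt in the inner product pulled back by [A] *)

Section orthonormalisation.
Context {R : realType} {E : lmodType R} {G : hilbertType R}.
Variable A : {linear E -> G}.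

(** Families and coefficients are indexed by [nat], with only the entries below [k] read, so that
    inductions on [k] need no casts between ordinal types. *)
Definition span_nat (k : nat) (b : nat -> E) : set E :=
  [set x | exists a : nat -> R, x = \sum_(i < k) a i *: b i].

(** It is the images that are orthonormal: coefficients of a projection in [G] are then at once
    coefficients in [E], where the Galerkin solution lives. *)
Definition orthonormal_image (k : nat) (u : nat -> E) :=
  forall i l, (i < k)%N -> (l < k)%N -> inner (A (u i)) (A (u l)) = (i == l)%:R.

Lemma inner_sum_orthonormal k u (a : nat -> R) i :
  orthonormal_image k u -> (i < k)%N ->
  inner (A (\sum_(l < k) a l *: u l)) (A (u i)) = a i.
Proof.
move=> ou ik; rewrite linear_sum inner_suml (bigD1 (Ordinal ik))//=.
rewrite linearZ innerZl ou// eqxx mulr1 big1 ?addr0// => l li.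
by rewrite linearZ innerZl ou// -(inj_eq val_inj)/= in li *; rewrite (negbTE li) mulr0.
Qed.

Lemma norm_sum_orthonormal k u (a : nat -> R) : orthonormal_image k u ->
  `|A (\sum_(l < k) a l *: u l)| ^+ 2 = \sum_(l < k) a l ^+ 2.
Proof.
move=> ou; rewrite -inner_norm [X in inner _ X]linear_sum inner_sumr; apply: eq_bigr => i _.
by rewrite linearZ innerZr inner_sum_orthonormal.
Qed.

Lemma gram_schmidt k (b : nat -> E) :
  (forall a : nat -> R, A (\sum_(i < k) a i *: b i) = 0 ->
     forall i, (i < k)%N -> a i = 0) ->
  exists u, orthonormal_image k u /\ span_nat k b = span_nat k u.
Proof.
elim: k b => [|k IH] b bP.
  exists b; split => //.
have /IH [u [ou bu]] : forall a : nat -> R, A (\sum_(i < k) a i *: b i) = 0 ->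
     forall i, (i < k)%N -> a i = 0.
  move=> a a0 i ik; have := bP (fun i => if (i < k)%N then a i else 0).
  rewrite big_ord_recr/= ltnn scale0r addr0.
  under eq_bigr do rewrite ltn_ord.
  by move=> /(_ a0 i (ltnW ik)); rewrite ik.
pose w := b k - \sum_(i < k) inner (A (b k)) (A (u i)) *: u i.
have Aw : A w != 0.
  apply/eqP => Aw0.
  have [a ea] : span_nat k b (\sum_(i < k) inner (A (b k)) (A (u i)) *: u i).
    by rewrite bu; exists (fun i => inner (A (b k)) (A (u i))).
  (* Were [A w] zero, it would be a relation among the images with coefficient 1 at [b k]. *)
  have := bP (fun i => if (i < k)%N then - a i else 1).
  rewrite big_ord_recr/= ltnn scale1r.
  under eq_bigr do rewrite ltn_ord scaleNr.
  rewrite sumrN -ea addrC => /(_ Aw0 k (ltnSn k)).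
  by rewrite ltnn => /eqP; rewrite oner_eq0.
have wu i : (i < k)%N -> inner (A w) (A (u i)) = 0.
  move=> ik; rewrite linearB innerBl.
  by rewrite (inner_sum_orthonormal (fun i => inner (A (b k)) (A (u i))) ou)// subrr.
have nw : `|A w| != 0 by rewrite normr_eq0.
pose v i := if (i < k)%N then u i else `|A w|^-1 *: w.
have vk : v k = `|A w|^-1 *: w by rewrite /v ltnn.
have vu i : (i < k)%N -> v i = u i by rewrite /v => ->.
have sv (a : nat -> R) : \sum_(i < k) a i *: v i = \sum_(i < k) a i *: u i.
  by apply: eq_bigr => i _; rewrite vu.
exists v; split => [i l|].
  rewrite !ltnS leq_eqVlt => /predU1P[->|ik]; rewrite leq_eqVlt => /predU1P[->|lk].
  - rewrite eqxx vk linearZ innerZl innerZr inner_norm/=.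
    by rewrite expr2 [X in _ * X]mulrA mulVf// mul1r mulVf.
  - by rewrite vk vu// linearZ innerZl wu// mulr0 gtn_eqF.
  - by rewrite vk vu// linearZ innerZr innerC wu// mulr0 ltn_eqF.
  - by rewrite !vu// ou.
have eb : b k = `|A w| *: v k + \sum_(i < k) inner (A (b k)) (A (u i)) *: u i.
  by rewrite vk scalerA divff// scale1r /w subrK.
apply/seteqP; split => x [a ->]; rewrite big_ord_recr/=.
  have [c ec] : span_nat k u (\sum_(i < k) a i *: b i) by rewrite -bu; exists a.
  (* Coefficients collected after substituting [eb] for [b k]; the converse inclusion inverts that
     relation. *)
  exists (fun i => if (i < k)%N then c i + a k * inner (A (b k)) (A (u i)) else
    a k * `|A w|).
  rewrite big_ord_recr/= ltnn ec [X in _ + a k *: X]eb.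
  under [in RHS]eq_bigr => i _ do rewrite ltn_ord vu// scalerDl -scalerA.
  rewrite big_split/= -scaler_sumr scalerDr -scalerA.
  by rewrite -!addrA; congr (_ + _); rewrite addrC.
rewrite sv vk.
have [c ec] : span_nat k b
    (\sum_(i < k) (a i - a k * `|A w|^-1 * inner (A (b k)) (A (u i))) *: u i).
  by rewrite bu; exists (fun i => a i - a k * `|A w|^-1 * inner (A (b k)) (A (u i))).
exists (fun i => if (i < k)%N then c i else a k * `|A w|^-1).
rewrite big_ord_recr/= ltnn.
under [in RHS]eq_bigr => i _ do rewrite ltn_ord.
rewrite -ec scalerA /w scalerBr addrA addrAC; congr (_ + _).
under [in RHS]eq_bigr => i _ do rewrite scalerBl -scalerA.
by rewrite sumrB -scaler_sumr.
Qed.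

End orthonormalisation.

Lemma subspace_orthonormal {R : realType} {E : lmodType R} {G : hilbertType R}
    (A : {linear E -> G}) k (V : set E) :
  subspace_of_dim k V -> (forall g, V g -> A g = 0 -> g = 0) ->
  exists u, orthonormal_image A k u /\ V = span_nat k u.
Proof.
move=> [b [bfree VE]] Ainj.
(* The basis is extended by 0 beyond [k]. *)
pose b' i := oapp b 0 (insub i : option 'I_k).
have b'E (i : 'I_k) : b' i = b i by rewrite /b' valK.
have VE' : V = span_nat k b'.
  rewrite VE; apply/seteqP; split => x [a ->].
    exists (fun i => oapp a 0 (insub i : option 'I_k)).
    by apply: eq_bigr => i _; rewrite b'E valK.
  by exists (fun i => a i); apply: eq_bigr => i _; rewrite b'E.
rewrite VE'; apply: gram_schmidt => a a0 i ik.
have : \sum_(i < k) a i *: b i = 0.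
  under eq_bigr do rewrite -b'E.
  apply: Ainj => //; rewrite VE'; by exists a.
by move=> /bfree/(_ (Ordinal ik)).
Qed.

(** * Orthogonal projection on the image of a finite-dimensional space *)

Section orthogonal_projection.
Context {R : realType} {E G : hilbertType R} (A : {linear E -> G}).
Variables (k : nat) (u : nat -> E).
Hypothesis ou : orthonormal_image A k u.

(** Preimage in the span of the orthogonal projection of [x]; for [x = A f] this is the Galerkin
    solution. *)
Definition projection_coord (x : G) : E := \sum_(i < k) inner x (A (u i)) *: u i.

Lemma span_projection_coord x : span_nat k u (projection_coord x).
Proof. by exists (fun i => inner x (A (u i))). Qed.

Lemma inner_projection x g : span_nat k u g ->
  inner (x - A (projection_coord x)) (A g) = 0.
Proof.
move=> [a ->]; rewrite [X in inner _ X]linear_sum inner_sumr big1// => i _.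
rewrite linearZ innerZr innerBl.
by rewrite (inner_sum_orthonormal (fun i => inner x (A (u i))) ou)// subrr mulr0.
Qed.

Lemma pythagoras_projection x g : span_nat k u g ->
  `|x - A g| ^+ 2 =
  `|x - A (projection_coord x)| ^+ 2 + `|A (projection_coord x - g)| ^+ 2.
Proof.
move=> [a ga]; have -> : x - A g =
    (x - A (projection_coord x)) + A (projection_coord x - g).
  by rewrite linearB addrA subrK.
rewrite normDsqr inner_projection ?mulr0 ?addr0//.
exists (fun i => inner x (A (u i)) - a i); rewrite /projection_coord ga -sumrB.
by apply: eq_bigr => i _; rewrite scalerBl.
Qed.

(** The choice made in [orth_proj] is harmless: two candidates differ by a vector of the image that
    is orthogonal to itself. *)
Lemma orth_projE x : orth_proj (A @` span_nat k u) x = A (projection_coord x).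
Proof.
apply: xget_unique => [|y [[g ug <-] gP]].
  split; first by exists (projection_coord x) => //; exact: span_projection_coord.
  by move=> _ [g ug <-]; exact: inner_projection.
have h := inner_projection x.
have ugx : span_nat k u (projection_coord x - g).
  have [a ->] := ug; exists (fun i => inner x (A (u i)) - a i).
  by rewrite -sumrB; apply: eq_bigr => i _; rewrite scalerBl.
have e : inner (A (projection_coord x - g)) (A (projection_coord x - g)) = 0.
  rewrite {1}linearB.
  have -> : A (projection_coord x) - A g =
      (x - A g) - (x - A (projection_coord x)) by rewrite opprB [RHS]addrC subrKA.
  rewrite innerBl h// subr0 gP//; by exists (projection_coord x - g).
move: e; rewrite inner_norm => /eqP; rewrite sqrf_eq0 normr_eq0 linearB subr_eq0.
by move=> /eqP ->.
Qed.

Lemma galerkinE f : (forall g, span_nat k u g -> A g = 0 -> g = 0) ->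
  galerkin A (span_nat k u) f = projection_coord (A f).
Proof.
move=> Ainj; apply: xget_unique => [|y [[a ya] Ay]].
  by split; [exact: span_projection_coord|rewrite orth_projE].
apply/eqP; rewrite -subr_eq0; apply/eqP/Ainj.
  exists (fun i => a i - inner (A f) (A (u i))).
  by rewrite ya -sumrB; apply: eq_bigr => i _; rewrite scalerBl.
by rewrite linearB Ay orth_projE subrr.
Qed.

Lemma norm_projection x : `|A (projection_coord x)| ^+ 2 =
  \sum_(i < k) inner x (A (u i)) ^+ 2.
Proof. exact: (norm_sum_orthonormal (fun i => inner x (A (u i))) ou). Qed.

Lemma norm_projection_le x : `|A (projection_coord x)| <= `|x|.
Proof.
rewrite -(@ler_pXn2r _ 2)// ?nnegrE//.
have /(pythagoras_projection x) : span_nat k u 0.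
  by exists (fun=> 0); rewrite big1// => i _; rewrite scale0r.
by rewrite linear0 !subr0 => ->; rewrite lerDr sqr_ge0.
Qed.

Lemma projection_coordB x y :
  projection_coord (x - y) = projection_coord x - projection_coord y.
Proof.
by rewrite /projection_coord -sumrB; apply: eq_bigr => i _; rewrite innerBl scalerBl.
Qed.

End orthogonal_projection.

(** * Stability and error of the Galerkin scheme *)

Section galerkin_approximation.
Context {R : realType} (H : smoothness_scale R).
Variables (S : R) (V : nat -> set (H 0)) (delta : nat -> R -> R).
Hypothesis approx : approximation_assumption S V delta.
Variables (G : hilbertType R) (A : {linear H 0 -> G}) (gamma : R).
Hypotheses (gamma_gt0 : 0 < gamma) (gamma_ltS : gamma < S).
Hypothesis A_smoothing : exists c1 c2 : R, [/\ 0 < c1, 0 < c2 &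
    forall f : H 0,
      c1 * `|scale_incl (- gamma) f| <= `|A f| <= c2 * `|scale_incl (- gamma) f|].

Lemma incl0 s t : s <= t -> scale_incl s (0 : H t) = 0.
Proof.
move=> st; have := @incl_linear _ H _ _ st (-1) 0 0.
by rewrite scaler0 addr0 => {1}->; rewrite scaleN1r addNr.
Qed.

(** Cauchy-Schwarz for the pairing of [H (- s)] with [H s]: rescale [g] to norm one and use the dual
    description of the negative norm. *)
Lemma inner_le_dual_norm s (f : H 0) (g : H s) : 0 < s ->
  inner f (scale_incl 0 g) <= `|scale_incl (- s) f| * `|g|.
Proof.
move=> s0.
have [->|g0] := eqVneq g 0.
  by rewrite (incl0 (ltW s0)) inner0r normr0 mulr0.
have ng : 0 < `|g| by rewrite normr_gt0.
have [C C0 CP] := @incl_bounded _ H _ _ s0.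
rewrite -ler_pdivrMr// (scale_dual _ (ltW s0)).
have eg : inner f (scale_incl 0 g) / `|g| = inner f (scale_incl 0 (`|g|^-1 *: g)).
  have := @incl_linear _ H _ _ (ltW s0) `|g|^-1 g 0; rewrite addr0 => ->.
  by rewrite (incl0 (ltW s0)) addr0 innerZr mulrC.
apply: ub_le_sup; last first.
  exists (`|g|^-1 *: g); last by rewrite eg.
  by rewrite /= normrZ normfV normr_id mulVf// gt_eqF.
exists (`|f| * C) => _ [h /= h1 <-].
rewrite (le_trans (Cauchy_Schwarz_inner _ _))// ler_wpM2l//.
by rewrite (le_trans (CP h))// ler_piMr// ltW.
Qed.

(* ‖g‖₀² = ⟨g, g⟩₀ ≤ ‖g‖_{-γ} ‖g‖_γ and the inverse estimate on V_j. *)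
Lemma galerkin_stability : exists2 C : R, 0 < C & forall j g, (0 < j)%N -> V j g ->
  `|g| <= C * ((delta j gamma)^-1 * `|A g|).
Proof.
have [c1 [c2 [c10 c20 Asm]]] := A_smoothing.
have [_ /(_ gamma gamma_gt0 gamma_ltS)[dpos _ _ [C C0 CP]]] := approx.
exists (C / c1) => [|j g j0 Vg]; first by rewrite divr_gt0.
have [g' g'g g'le] := CP j j0 g Vg.
have [->|g0] := eqVneq g 0.
  by rewrite normr0 !mulr_ge0// ?invr_ge0// ltW// dpos.
have ng : 0 < `|g| by rewrite normr_gt0.
rewrite -(ler_pM2r ng) -expr2 -inner_norm -{2}g'g.
rewrite (le_trans (inner_le_dual_norm _ _ gamma_gt0))//.
have /andP[+ _] := Asm g; rewrite -ler_pdivlMl// => Ag.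
rewrite (le_trans (ler_pM _ _ Ag g'le))//.
by rewrite le_eqVlt; apply/orP; left; apply/eqP; ring.
Qed.

Lemma A_inj_subspace j g : (0 < j)%N -> V j g -> A g = 0 -> g = 0.
Proof.
have [C C0 CP] := galerkin_stability => j0 Vg Ag.
have := CP j g j0 Vg; rewrite Ag normr0 !mulr0 normr_le0.
by move/eqP.
Qed.

Lemma galerkin_basis j : (0 < j)%N -> exists2 u,
  orthonormal_image A j.-1 u & V j = span_nat j.-1 u /\
  forall f, galerkin A (V j) f = projection_coord A j.-1 u (A f).
Proof.
move=> j0; have [Vdim _] := approx.
have [u [ou Vu]] := subspace_orthonormal (Vdim j j0)
  (fun g => @A_inj_subspace j g j0).
exists u => //; split => // f; rewrite Vu galerkinE// => g ug.
by apply: (@A_inj_subspace j); rewrite ?Vu.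
Qed.

(** Orthonormalisation with the identity in place of [A] yields the orthogonal projection on V_j, at
    which the infimum of the approximation assumption is attained. *)
Lemma best_approximation j (f : H 0) : (0 < j)%N -> exists2 g, V j g &
  [/\ forall v, V j v -> inner (f - g) v = 0 &
      `|f - g| <= inf [set `|f - v| | v in V j]].
Proof.
move=> j0; have [Vdim _] := approx.
have [u [ou Vu]] := @subspace_orthonormal _ _ (H 0) idfun _ _ (Vdim j j0)
  (fun _ _ => id).
exists (projection_coord idfun j.-1 u f).
  by rewrite Vu; exact: span_projection_coord.
split=> [v|]; first by rewrite Vu => /(inner_projection ou f).
apply: lb_le_inf.
  exists `|f - projection_coord idfun j.-1 u f|, (projection_coord idfun j.-1 u f) => //.
  by rewrite Vu; exact: span_projection_coord.
move=> _ [v + <-]; rewrite Vu => /(pythagoras_projection ou f)/= vP.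
by rewrite -(@ler_pXn2r _ 2)// ?nnegrE// vP lerDl sqr_ge0.
Qed.

(** Compare with the best approximation g of f0. Stability costs a factor 1/δ(j,γ), but f0 - g is
    orthogonal to V_j, and duality (the Aubin-Nitsche argument) regains δ(j,γ) in the norm of order
    -γ. What remains is ‖f0 - g‖, of order δ(j,β). *)
Lemma galerkin_error beta (f0 : H 0) : 0 < beta -> beta < S ->
  (exists g : H beta, scale_incl 0 g = f0) ->
  exists2 C : R, 0 < C & forall j, (0 < j)%N ->
    `|galerkin A (V j) f0 - f0| <= C * delta j beta.
Proof.
move=> b0 bS [fb fbf].
have [Cst Cst0 Cstab] := galerkin_stability.
have [c1 [c2 [c10 c20 Asm]]] := A_smoothing.
have [_ apx] := approx.
have [dpos _ [C C0 CP] _] := apx _ gamma_gt0 gamma_ltS.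
have [bpos _ [D D0 DP] _] := apx _ b0 bS.
(* The summand 1 next to the norm of [fb] keeps the constant positive when [fb] vanishes. *)
exists ((Cst * c2 * C + 1) * (D * (`|fb| + 1))).
  by rewrite !mulr_gt0// ltr_wpDl// !mulr_ge0// ltW.
move=> j j0; have [u ou [Vu ->]] := galerkin_basis j0.
have [g Vg [gorth gle]] := best_approximation f0 j0.
have dj := dpos j j0; have bj := bpos j j0.
have fg : `|f0 - g| <= D * (`|fb| + 1) * delta j beta.
  rewrite (le_trans gle)// -fbf (le_trans (DP j j0 fb))//.
  rewrite -mulrA ler_wpM2l ?(ltW D0)// mulrC ler_wpM2r ?(ltW bj)//.
  by rewrite lerDl.
have dual : `|scale_incl (- gamma) (f0 - g)| <= `|f0 - g| * (C * delta j gamma).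
  rewrite scale_dual ?(ltW gamma_gt0)//; apply: ge_sup.
    exists (inner (f0 - g) (scale_incl 0 (0 : H gamma))), 0 => //=.
    by rewrite normr0.
  move=> _ [h /= h1 <-].
  (* By orthogonality, the best approximation of a test function may be subtracted from it. *)
  have [v Vv [_ vle]] := best_approximation (scale_incl 0 h) j0.
  have -> : inner (f0 - g) (scale_incl 0 h) = inner (f0 - g) (scale_incl 0 h - v).
    by rewrite innerBr (gorth v Vv) subr0.
  rewrite (le_trans (Cauchy_Schwarz_inner _ _))// ler_wpM2l//.
  rewrite (le_trans vle)// (le_trans (CP j j0 h))// ler_wpM2l ?(ltW C0)//.
  by rewrite ler_piMr// ltW.
(* Since the scheme fixes V_j, the Galerkin solution of f0 minus g is that of f0 - g, to which
   stability applies. *)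
have pg : projection_coord A j.-1 u (A g) = g.
  apply/eqP; rewrite -subr_eq0; apply/eqP; apply: (A_inj_subspace j0).
    rewrite Vu; move: Vg; rewrite Vu => -[a ga].
    exists (fun i => inner (A g) (A (u i)) - a i).
    rewrite /projection_coord {2}ga -sumrB.
    by apply: eq_bigr => i _; rewrite scalerBl.
  apply/eqP; rewrite -normr_eq0 -sqrf_eq0.
  move: Vg; rewrite Vu => Vg; have := pythagoras_projection ou (A g) Vg.
  rewrite subrr normr0 expr0n/= => /esym/eqP.
  by rewrite paddr_eq0 ?sqr_ge0// => /andP[].
have h1 : `|projection_coord A j.-1 u (A f0) - g| <= Cst * c2 * C * `|f0 - g|.
  rewrite -{1}pg -projection_coordB -linearB.
  rewrite (le_trans (Cstab j _ j0 _))//.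
    by rewrite Vu; exact: span_projection_coord.
  rewrite -!mulrA ler_wpM2l ?(ltW Cst0)//.
  rewrite ler_pdivrMl// (le_trans (norm_projection_le ou _))//.
  have /andP[_ /le_trans ->//] := Asm (f0 - g).
  rewrite mulrCA ler_wpM2l ?(ltW c20)// (le_trans dual)//.
  by rewrite le_eqVlt; apply/orP; left; apply/eqP; ring.
rewrite -(subrKA g) addrC (le_trans (ler_normD _ _))//.
rewrite -mulrA mulrDl mul1r addrC lerD//; last by rewrite distrC.
by rewrite (le_trans h1)// ler_wpM2l// !mulr_ge0// ltW.
Qed.

End galerkin_approximation.

(** * Gaussian white noise *)

Section normal_integrals.
Context {R : realType}.
Notation mu := lebesgue_measure.

(** The Radon-Nikodym derivative and the explicit density have the same integral on every measurable
    set, hence agree almost everywhere. *)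
Lemma ge0_integral_normal_prob (m s : R) (f : R -> \bar R) :
  measurable_fun setT f -> (forall x, 0 <= f x)%E ->
  (\int[normal_prob m s]_x f x = \int[mu]_x (f x * (normal_pdf m s x)%:E))%E.
Proof.
move=> mf f0; have dom := normal_prob_dominates m s.
have mpdf : measurable_fun setT (fun x => (normal_pdf m s x)%:E).
  by apply/measurable_EFinP; exact: measurable_normal_pdf.
rewrite -(Radon_Nikodym_SigmaFinite.change_of_variables dom)//.
have mRN : measurable_fun setT (Radon_Nikodym_SigmaFinite.f (normal_prob m s) mu).
  exact: measurable_int (Radon_Nikodym_SigmaFinite.f_integrable dom).
apply: ge0_ae_eq_integral => //.
- exact: emeasurable_funM.
- exact: emeasurable_funM.
- by move=> x _; rewrite mule_ge0// Radon_Nikodym_SigmaFinite.f_ge0.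
- by move=> x _; rewrite mule_ge0// lee_fin normal_pdf_ge0.
- apply: ae_eqe_mul2l; apply: integral_ae_eq => //.
    exact: Radon_Nikodym_SigmaFinite.f_integrable.
  by move=> E _ mE; rewrite -Radon_Nikodym_SigmaFinite.f_integral.
Qed.

(** Completing the square: exponential tilting only moves the mean. *)
Lemma normal_expR_pdf (m s t x : R) : s != 0 ->
  expR (t * x) * normal_pdf m s x =
  expR (t * m + s ^+ 2 * t ^+ 2 / 2) * normal_pdf (m + s ^+ 2 * t) s x.
Proof.
move=> s0; rewrite !normal_pdfE//= mulrCA [RHS]mulrCA; congr (_ * _).
by rewrite /normal_fun -!expRD; congr expR; field.
Qed.

Lemma normal_mgf (m s t : R) : s != 0 ->
  (\int[normal_prob m s]_x (expR (t * x))%:E =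
   (expR (t * m + s ^+ 2 * t ^+ 2 / 2))%:E)%E.
Proof.
move=> s0; rewrite ge0_integral_normal_prob; last 2 first.
- by apply/measurable_EFinP; apply: measurableT_comp.
- by move=> x; rewrite lee_fin expR_ge0.
under eq_integral do rewrite -EFinM normal_expR_pdf// EFinM.
rewrite ge0_integralZl//; last 2 first.
- by apply/measurable_EFinP; exact: measurable_normal_pdf.
- by move=> x _; rewrite lee_fin normal_pdf_ge0.
by rewrite integral_normal_pdf mule1.
Qed.

(** Multiplying the standard normal density by e^{x²/4} gives √2 times the centred normal density of
    variance 2. *)
Lemma normal_expR_sqr :
  (\int[normal_prob 0 1]_x (expR (x ^+ 2 / 4))%:E = (Num.sqrt 2)%:E :> \bar R)%E.
Proof.
have s20 : (Num.sqrt 2 : R) != 0 by rewrite gt_eqF// sqrtr_gt0.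
rewrite ge0_integral_normal_prob; last 2 first.
- apply/measurable_EFinP; apply: measurableT_comp => //.
  by apply: measurable_funM => //; exact: measurable_funX.
- by move=> x; rewrite lee_fin expR_ge0.
have E x : expR (x ^+ 2 / 4) * normal_pdf 0 1 x =
    (Num.sqrt 2 : R) * normal_pdf 0 (Num.sqrt 2) x.
  rewrite !normal_pdfE// mulrCA [RHS]mulrA; congr (_ * _).
    rewrite /normal_peak expr1n mul1r sqr_sqrtr// -mulrnAr sqrtrM//.
    by rewrite invfM mulrA divff// mul1r.
  rewrite /normal_fun -!expRD; congr expR.
  by rewrite sqr_sqrtr// subr0 expr1n; field.
under eq_integral do rewrite -EFinM E EFinM.
rewrite ge0_integralZl//; last 2 first.
- by apply/measurable_EFinP; exact: measurable_normal_pdf.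
- by move=> x _; rewrite lee_fin normal_pdf_ge0.
by rewrite integral_normal_pdf mule1.
Qed.

End normal_integrals.

(** * Covariance, linearity and Laplace transform of white noise *)

Section white_noise_moments.
Context (R : realType) (d : measure_display) (Omega : measurableType d).
Context (P : probability Omega R) (G : hilbertType R) (xi : G -> {RV P >-> R}).
Hypothesis xi_noise : white_noise xi.

(** Integrability comes first: squares have a finite integral, and |ab| <= a² + b² then dominates
    the product. *)
Lemma noise_covariance v w :
  has_integral P (fun o => xi v o * xi w o) (inner v w).
Proof.
have [_ _ cov] := xi_noise.
have sq u : has_integral P (fun o => xi u o * xi u o) (inner u u).
  apply: ge0_has_integral => [|o|]; first exact: measurable_funM.
    by rewrite -expr2 sqr_ge0.
  by have := cov u u; rewrite unlock.
have [x hx] : exists x, has_integral P (fun o => xi v o * xi w o) x.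
  apply: (dominated_has_integral _ _ (has_integralD (sq v) (sq w))).
    exact: measurable_funM.
  move=> o; rewrite ler_norml.
  have := sqr_ge0 (xi v o - xi w o); have := sqr_ge0 (xi v o + xi w o).
  have := sqr_ge0 (xi v o); have := sqr_ge0 (xi w o).
  by rewrite !expr2 => *; apply/andP; split; nra.
have := cov v w; rewrite unlock; case: (hx) => _ -> [xvw].
by rewrite -xvw.
Qed.

(** The difference of the two sides has second moment 0, by bilinearity of the covariance. The null
    set depends on [v], [w] and [c]. *)
Lemma noise_linear v w (c : R) :
  {ae P, forall o, xi (v + c *: w) o = xi v o + c * xi w o}.
Proof.
set u := v + c *: w.
have : has_integral P (fun o => (xi u o - xi v o - c * xi w o) ^+ 2) 0.
  have := has_integralD (noise_covariance u u) (has_integralD (noise_covariance v v)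
    (has_integralD (has_integralZ (c ^+ 2) (noise_covariance w w))
    (has_integralD (has_integralZ (-2) (noise_covariance u v))
    (has_integralD (has_integralZ (- 2 * c) (noise_covariance u w))
    (has_integralZ (2 * c) (noise_covariance v w)))))).
  rewrite [X in has_integral P _ X](_ : _ = 0).
    by congr (has_integral P _ _); apply/funext => o; ring.
  rewrite /u !(innerDl, innerDr, innerZl, innerZr) (innerC w v); ring.
move/has_integral0_ae => /(_ (fun o => sqr_ge0 _)).
by apply: filterS => o /eqP; rewrite sqrf_eq0 => /eqP; lra.
Qed.

Lemma noise_mgf_law w : exists m s : R, forall t,
  has_integral P (fun o => expR (t * xi w o)) (expR (t * m + s ^+ 2 * t ^+ 2 / 2)).
Proof.
have [gp _ _] := xi_noise.
have [m [s msP]] := gp 1%N (fun=> w) (fun=> 1).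
have law B : measurable B -> P (xi w @^-1` B) = gaussian_law m s B.
  move=> mB; rewrite -msP//; congr (P _); apply/seteqP; split => o /=;
  by rewrite big_ord1 mul1r.
exists m, s => t; apply: ge0_has_integral => [|o|].
- by apply: measurableT_comp => //; exact: measurable_funM.
- exact: expR_ge0.
have me : measurable_fun setT (fun x : R => (expR (t * x))%:E).
  by apply/measurable_EFinP; apply: measurableT_comp => //; exact: mulrl_measurable.
have mX : measurable_fun setT (xi w : Omega -> measurableTypeR R).
  exact: (measurable_funPT (xi w)).
transitivity (\int[pushforward P (xi w : Omega -> measurableTypeR R)]_x
    (expR (t * x))%:E)%E.
  by rewrite (ge0_integral_pushforward mX).
have [s0|s0] := eqVneq s 0.
  rewrite (@eq_measure_integral _ _ _ _ (dirac (m : measurableTypeR R))) => [|B mB _].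
    by rewrite integral_dirac// diracT mul1e s0 expr0n/= !mul0r addr0.
  by rewrite [LHS]law// /gaussian_law s0 eqxx.
rewrite -(normal_mgf m t s0); apply: eq_measure_integral => B mB _.
by rewrite [LHS]law// /gaussian_law (negbTE s0).
Qed.

(** The parameters of the Gaussian law are recovered from the moments: the mean from 1 + tx <=
    e^{tx}, the variance from a second-order difference quotient of the Laplace transform at 0. *)
Lemma noise_mgf w : has_integral P (fun o => expR (xi w o)) (expR (`|w| ^+ 2 / 2)).
Proof.
have [m [s ms]] := noise_mgf_law w.
have X2 := noise_covariance w w.
have one : has_integral P (fun=> 1) 1.
  apply: ge0_has_integral => //.
  by rewrite integral_cst// mul1e; exact: probability_setT.
have X1 : has_integral P (xi w) 0.
  have [x hx] : exists x, has_integral P (xi w) x.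
    apply: (dominated_has_integral _ _ (has_integralD one X2)) => //.
    move=> o; have := sqr_ge0 (`|xi w o| - 1); have := real_normK (num_real (xi w o)).
    by have := normr_ge0 (xi w o); nra.
  have [_ + _] := xi_noise => /(_ w); rewrite unlock.
  by case: (hx) => _ -> [x0]; rewrite -x0.
(* Integrating 1 + tξ <= e^{tξ} with Eξ = 0 gives 0 <= tm + s²t²/2; the choice t = -m/(s² + 1) makes
   the right side negative unless m = 0. *)
have m0 : m = 0.
  have D0 : 0 < s ^+ 2 + 1 by rewrite ltr_wpDl// sqr_ge0.
  have := @le_has_integral _ _ _ P _ _ _ _ _
    (has_integralD one (has_integralZ (- m / (s ^+ 2 + 1)) X1)) (ms (- m / (s ^+ 2 + 1))).
  move=> /(_ (fun o => expR_ge1Dx _)).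
  rewrite mulr0 addr0 -[X in X <= _]expR0 ler_expR.
  have -> : - m / (s ^+ 2 + 1) * m + s ^+ 2 * (- m / (s ^+ 2 + 1)) ^+ 2 / 2 =
     - (m / (s ^+ 2 + 1)) ^+ 2 * (s ^+ 2 / 2 + 1) by field; rewrite gt_eqF.
  rewrite mulNr oppr_ge0 pmulr_lle0; last by rewrite ltr_wpDl// divr_ge0// sqr_ge0.
  move=> h; have : (m / (s ^+ 2 + 1)) ^+ 2 = 0.
    by apply/eqP; rewrite eq_le h sqr_ge0.
  move/eqP; rewrite sqrf_eq0 mulf_eq0 invr_eq0 (gt_eqF D0) orbF.
  by move/eqP.
suff sw : s ^+ 2 = `|w| ^+ 2.
  have := ms 1; rewrite m0 mulr0 add0r expr1n mulr1 sw.
  by under eq_fun do rewrite mul1r.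
pose h (n : nat) : R := n.+1%:R^-1.
have hP n : 0 < h n <= 1.
  by rewrite /h invr_gt0 ltr0n/= invf_le1 ?ltr0n// ler1n.
have h0 : h n @[n --> \oo] --> 0 by exact: cvg_harmonic.
have h20 : h n ^+ 2 @[n --> \oo] --> 0.
  by rewrite -(mulr0 0); under eq_fun do rewrite expr2; exact: cvgM.
have h2P n : 0 < h n ^+ 2 <= 1.
  by have /andP[a b] := hP n; rewrite exprn_gt0//= exprn_ile1// ltW.
pose F n (x : R) := ((expR (h n * (x / 2)) - 1) / h n - (expR (h n * (- (x / 2))) - 1) / h n) ^+ 2.
have FE n x : F n x = (h n ^+ 2)^-1 * (expR (h n * x) + expR (- h n * x) - 2 * 1).
  have /andP[hn _] := hP n; rewrite /F.
  have -> : h n * x = h n * (x / 2) + h n * (x / 2) by field.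
  have -> : - h n * x = h n * (- (x / 2)) + h n * (- (x / 2)) by field.
  rewrite !expRD.
  have : expR (h n * (x / 2)) * expR (h n * - (x / 2)) = 1.
    by rewrite -expRD mulrN subrr expR0.
  set a := expR _; set b := expR _ => ab.
  rewrite -[X in _ - 2 * X]ab; field; by rewrite gt_eqF.
have iF n : has_integral P (fun o => F n (xi w o))
    ((h n ^+ 2)^-1 * (expR (s ^+ 2 * h n ^+ 2 / 2) + expR (s ^+ 2 * h n ^+ 2 / 2) - 2 * 1)).
  under [X in has_integral _ X]eq_fun do rewrite FE.
  have := ms (h n); have := ms (- h n); rewrite m0 !mulr0 !add0r sqrrN => b a.
  by apply: has_integralZ; apply: has_integralB; [exact: has_integralD|exact: has_integralZ].
have := has_integral_cvg iF (f := fun o => xi w o * xi w o)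
    (g := fun o => 4 * (2 * 1 + (expR (2 * xi w o) + expR (- 2 * xi w o))))
    (y := 4 * (2 * 1 + (expR (2 * m + s ^+ 2 * 2 ^+ 2 / 2) +
                        expR (- 2 * m + s ^+ 2 * (-2) ^+ 2 / 2)))).
case=> [ o|n o| |x + cx].
- rewrite -expr2 {2}(_ : xi w o = xi w o / 2 - (- (xi w o / 2))); last by field.
  rewrite /F !expr2.
  by apply: cvgM; apply: cvgB; exact: cvg_expR_diff.
(* Both quotients are at most p + q in absolute value, where p = e^ξ, q = e^{-ξ} and pq = 1, so F <=
   4 (p² + q² + 2). *)
- rewrite ger0_norm ?sqr_ge0// /F.
  have e1 := expR_diff_bound (xi w o / 2) (hP n).
  have e2 := expR_diff_bound (- (xi w o / 2)) (hP n).
  move: e1 e2; have -> : 2 * (xi w o / 2) = xi w o by field.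
  have -> : 2 * - (xi w o / 2) = - xi w o by field.
  rewrite opprK; set a := (_ / _); set b := (_ / _).
  have -> : expR (2 * xi w o) = expR (xi w o) ^+ 2.
    by rewrite -expRM_natl.
  have -> : expR (- 2 * xi w o) = expR (- xi w o) ^+ 2.
    by rewrite -expRM_natl mulrN mulNr.
  have : expR (xi w o) * expR (- xi w o) = 1 by rewrite -expRD subrr expR0.
  set p := expR _; set q := expR _ => pq e1 e2.
  rewrite (addrC q p) in e2.
  have e3 : `|a - b| <= 2 * (p + q).
    by rewrite (le_trans (ler_normB _ _))// mulrDl mul1r lerD.
  rewrite -real_normK ?num_real//.
  have : `|a - b| ^+ 2 <= (2 * (p + q)) ^+ 2.
    by rewrite ler_pXn2r ?nnegrE// mulr_ge0// addr_ge0// expR_ge0.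
  by nra.
- apply: has_integralZ; apply: has_integralD; first exact: has_integralZ.
  by apply: has_integralD; exact: ms.
- move=> /(has_integral_unique X2); rewrite inner_norm => ->.
  apply/esym/(cvg_unique _ cx) => //.
  have e2 : 2 * (s ^+ 2 / 2) = s ^+ 2 by field.
  rewrite /= -[X in _ --> X]e2.
  (* The integrals form a first-order quotient with step h², which tends to s². *)
  have E n : (h n ^+ 2)^-1 * (expR (s ^+ 2 * h n ^+ 2 / 2) +
      expR (s ^+ 2 * h n ^+ 2 / 2) - 2 * 1) =
      2 * ((expR (h n ^+ 2 * (s ^+ 2 / 2)) - 1) / h n ^+ 2).
    have -> : h n ^+ 2 * (s ^+ 2 / 2) = s ^+ 2 * h n ^+ 2 / 2 by field.
    by field; have /andP[hn _] := hP n; rewrite gt_eqF.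
  under eq_fun => n do rewrite E.
  by apply: cvgM; [exact: cvg_cst|exact: cvg_expR_diff].
Qed.

End white_noise_moments.

(** * Measurability for the product sigma-field *)

Section path_measurability.
Context {R : realType} {I : Type}.

Lemma measurable_coord (i : I) :
  measurable_fun setT (fun y : path_space R I => y i).
Proof.
by move=> _ B mB; rewrite setTI; apply: sub_sigma_algebra; exists i, B.
Qed.

Lemma measurable_path (d : measure_display) (T : measurableType d)
    (F : T -> path_space R I) :
  (forall i, measurable_fun setT (fun t => F t i)) -> measurable_fun setT F.
Proof.
move=> mF; apply: (@measurability _ _ T (path_space R I) setT F (@cylinders R I) erefl).
move=> _ [_ [i [B [mB ->]]] <-].
by have := mF i measurableT B mB.
Qed.

End path_measurability.

(** * Step functions as limits of iterated polynomials of a sine *)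

Section step_iteration.
Context {R : realType}.
Implicit Types u : R.

(* Fixes 0, 1/2 and 1; its iterates push [0, 1/2[ to 0 and ]1/2, 1] to 1. *)
Definition smoothstep u := u * (u * (3 - 2 * u)).

Definition half_step u : R :=
  if u < 2^-1 then 0 else if u == 2^-1 then 2^-1 else 1.

Lemma smoothstepC u : smoothstep (1 - u) = 1 - smoothstep u.
Proof. by rewrite /smoothstep; ring. Qed.

Lemma smoothstep_itv u : 0 <= u <= 1 -> 0 <= smoothstep u <= 1.
Proof.
move=> /andP[u0 u1]; have q0 v : 0 <= v -> v <= 1 -> 0 <= smoothstep v.
  by move=> v0 v1; rewrite /smoothstep !mulr_ge0//; lra.
rewrite q0//=; have : 0 <= smoothstep (1 - u) by apply: q0; lra.
by rewrite smoothstepC; lra.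
Qed.

Lemma iter_smoothstep_itv n u : 0 <= u <= 1 -> 0 <= iter n smoothstep u <= 1.
Proof. by move=> u01; elim: n => // n IH; rewrite iterS smoothstep_itv. Qed.

(** Started below 1/2, the iterates stay below [u], and each application multiplies by at most r =
    u(3 - 2u) < 1. *)
Lemma iter_smoothstep_lt u : 0 <= u < 2^-1 ->
  iter n smoothstep u @[n --> \oo] --> 0.
Proof.
move=> /andP[u0 u1]; pose r := u * (3 - 2 * u).
have r0 : 0 <= r by rewrite mulr_ge0//; lra.
have r1 : r < 1 by rewrite /r; nra.
have h n : 0 <= iter n smoothstep u <= r ^+ n * u.
  elim: n => [|n /andP[IH0 IH1]]; first by rewrite expr0 mul1r lexx u0.
  have IHu : iter n smoothstep u <= u.
    by rewrite (le_trans IH1)// ler_piMl// exprn_ile1// ltW.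
  rewrite iterS /smoothstep; set v := iter n _ _ in IH0 IH1 IHu *.
  have rv : v * (3 - 2 * v) <= r by rewrite /r; nra.
  apply/andP; split; first by rewrite !mulr_ge0//; lra.
  rewrite (_ : r ^+ n.+1 * u = (r ^+ n * u) * r); last by rewrite exprSr; ring.
  by apply: ler_pM => //; rewrite mulr_ge0//; lra.
apply: (@squeeze_cvgr _ _ _ _ (cst 0) (fun n => r ^+ n * u)).
- by apply: nearW => n; exact: h.
- exact: cvg_cst.
- rewrite -[X in _ --> X](mul0r u); apply: cvgM; last exact: cvg_cst.
  by apply: cvg_expr; rewrite ger0_norm.
Qed.

Lemma iter_smoothstep_cvg u : 0 <= u <= 1 ->
  iter n smoothstep u @[n --> \oo] --> half_step u.
Proof.
move=> /andP[u0 u1]; rewrite /half_step.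
case: ltP => [u2|]; first by apply: iter_smoothstep_lt; rewrite u0.
rewrite le_eqVlt eq_sym; case: eqP => /= [->{u u0 u1} _|_ u2].
  rewrite (_ : (fun n => _) = cst (2^-1)); first exact: cvg_cst.
  apply/funext => n /=; by elim: n => //= n ->; rewrite /smoothstep; field.
have iC n : iter n smoothstep u = 1 - iter n smoothstep (1 - u).
  by elim: n => /= [|n ->]; [ring|rewrite smoothstepC].
rewrite (_ : (fun n => _) = (fun n => 1 - iter n smoothstep (1 - u))); last exact/funext.
have : 1 - iter n smoothstep (1 - u) @[n --> \oo] --> 1 - (0 : R).
  apply: cvgB; first exact: cvg_cst.
  by apply: iter_smoothstep_lt; apply/andP; split; lra.
by rewrite subr0.
Qed.

(** For large n the argument x/(n + 1) lies in (-π, π), where the sine has the sign of its argument;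
    the sequence is eventually constant. *)
Lemma half_step_sin_cvg (x : R) :
  half_step ((1 + sin (n.+1%:R^-1 * x)) / 2) @[n --> \oo] -->
  (if x < 0 then 0 else if x == 0 then 2^-1 else 1 : R).
Proof.
have pos z : 0 < z -> \forall n \near \oo, 0 < sin (n.+1%:R^-1 * z :> R).
  move=> z0; near=> n; apply: sin_gt0_pi; rewrite mulr_gt0//= mulrC.
  rewrite (@le_lt_trans _ _ 1)//; last by rewrite (lt_le_trans _ (pi_ge2 R))// ltr1n.
  rewrite ler_pdivrMr ?ltr0n// mul1r.
  near: n; exists (Num.trunc z).+1 => // n /= zn.
  by rewrite (le_trans (ltW (truncnS_gt z)))// ler_nat (leq_trans zn).
case: (ltgtP x 0) => x0.
- have nx : 0 < - x by rewrite oppr_gt0.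
  apply: cvg_near_cst; move: (pos _ nx); apply: filterS => n.
  rewrite mulrN sinN oppr_gt0 /half_step => s0.
  by rewrite ifT//; lra.
- apply: cvg_near_cst; move: (pos _ x0); apply: filterS => n s0.
  by rewrite /half_step ifF; [rewrite ifF//; apply/eqP; lra|apply/negP; lra].
- apply: cvg_near_cst; apply: nearW => n.
  by rewrite x0 mulr0 sin0 addr0 mul1r /half_step ltxx eqxx.
Unshelve. all: by end_near. Qed.

(** Termwise comparison with the exponential series at |x|, whose partial sums increase to
    e^{|x|}. *)
Lemma series_sin_coeff_bound (x : R) n : `|series (sin_coeff x) n| <= expR `|x|.
Proof.
apply: (@le_trans _ _ (series (exp_coeff `|x|) n)).
  rewrite /series/= (le_trans (ler_norm_sum _ _ _))//; apply: ler_sum => i _.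
  rewrite /sin_coeff /exp_coeff/= !normrM normfV normrX normrN1 expr1n mulr1.
  rewrite normrX (ger0_norm (ler0n _ _)) (ger0_norm (ler0n _ i`!)).
  rewrite -mulrA ler_piMl//; by case: odd.
rewrite /expR; apply: nondecreasing_cvgn_le; last exact: is_cvg_series_exp_coeff.
move=> a b ab; rewrite -subr_ge0 sub_series_geq//.
by apply: sumr_ge0 => i _; exact: exp_coeff_ge0.
Qed.

End step_iteration.

(** * The Cameron-Martin formula *)

Section cameron_martin.
Context (R : realType) (d : measure_display) (Omega : measurableType d).
Context (P : probability Omega R) (G : hilbertType R) (xi : G -> {RV P >-> R}).
Hypothesis xi_noise : white_noise xi.
Variable h : G.

Local Notation T := (path_space R G).

Definition noise_path (o : Omega) : T := fun w => xi w o.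
Definition shifted_path (o : Omega) : T := fun w => xi w o + inner h w.

(** [W1] is the weight e^{y(v)} on the shifted path; [W2] is the same weight on the unshifted path,
    times the Cameron-Martin density. *)
Let W1 v o := expR (xi v o + inner h v).
Let W2 v o := expR (xi v o + (xi h o - `|h| ^+ 2 / 2)).

Lemma measurable_noise_path : measurable_fun setT noise_path.
Proof. by apply: measurable_path => w; exact: (measurable_funPT (xi w)). Qed.

Lemma measurable_shifted_path : measurable_fun setT shifted_path.
Proof. by apply: measurable_path => w; exact: measurable_funD. Qed.

Let mW1 v : measurable_fun setT (W1 v).
Proof. by apply: measurableT_comp => //; exact: measurable_funD. Qed.

Let mW2 v : measurable_fun setT (W2 v).
Proof.
apply: measurableT_comp => //; apply: measurable_funD => //.
exact: measurable_funB.
Qed.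

(* The weights e^{ξ(v)} are there to make the class stable under multiplication by
   exponentials of coordinates; v = 0 is the Cameron-Martin formula for g. *)
Definition cm_class (g : T -> R) := measurable_fun setT g /\
  forall v, exists2 x, has_integral P (fun o => g (shifted_path o) * W1 v o) x &
                       has_integral P (fun o => g (noise_path o) * W2 v o) x.

(** Multipliers of the class, rather than its members, form an algebra: a product acts as a
    composition. *)
Definition cm_mult (u : T -> R) := measurable_fun setT u /\
  forall g, cm_class g -> cm_class (fun y => u y * g y).

(** Both sides are Laplace transforms: the second weight is almost surely e^{-‖h‖²/2} e^{ξ(v+h)},
    and the common value is e^{‖v‖²/2 + ⟨h,v⟩}. *)
Lemma cm_class1 : cm_class (fun=> 1).
Proof.
split=> // v.
have E : expR (`|v + h| ^+ 2 / 2 - `|h| ^+ 2 / 2) = expR (`|v| ^+ 2 / 2 + inner h v).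
  by rewrite normDsqr (innerC v h); congr expR; field.
exists (expR (`|v| ^+ 2 / 2 + inner h v)).
  under eq_fun do rewrite mul1r /W1 addrC expRD.
  by rewrite addrC expRD; apply: has_integralZ; exact: noise_mgf.
rewrite -E; under eq_fun do rewrite mul1r.
apply: (@has_integral_ae _ _ _ P (fun o => expR (- (`|h| ^+ 2 / 2)) * expR (xi (v + h) o))) => //.
  have := noise_linear xi_noise v h 1; rewrite scale1r.
  apply: filterS => o ->; rewrite /W2 -expRD; congr expR; ring.
by rewrite [X in has_integral _ _ (expR X)]addrC expRD; apply: has_integralZ;
  exact: noise_mgf.
Qed.

Lemma cm_multZ (a : R) u : cm_mult u -> cm_mult (fun y => a * u y).
Proof.
move=> [mu uP]; split; first exact: measurable_funM.
move=> g cg; have [mug ugP] := uP _ cg; split.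
  by apply: measurable_funM; [exact: measurable_funM|exact: cg.1].
move=> v; have [x x1 x2] := ugP v; exists (a * x).
  by under eq_fun do rewrite -(mulrA a) -(mulrA a); exact: has_integralZ.
by under eq_fun do rewrite -(mulrA a) -(mulrA a); exact: has_integralZ.
Qed.

Lemma cm_multD u1 u2 : cm_mult u1 -> cm_mult u2 -> cm_mult (fun y => u1 y + u2 y).
Proof.
move=> [mu1 u1P] [mu2 u2P]; split; first exact: measurable_funD.
move=> g cg; have [m1 g1] := u1P _ cg; have [m2 g2] := u2P _ cg; split.
  by apply: measurable_funM; [exact: measurable_funD|exact: cg.1].
move=> v; have [x x1 x2] := g1 v; have [y y1 y2] := g2 v; exists (x + y).
  by under eq_fun do rewrite !mulrDl; exact: has_integralD.
by under eq_fun do rewrite !mulrDl; exact: has_integralD.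
Qed.

Lemma cm_multM u1 u2 : cm_mult u1 -> cm_mult u2 -> cm_mult (fun y => u1 y * u2 y).
Proof.
move=> [mu1 u1P] [mu2 u2P]; split; first exact: measurable_funM.
by move=> g cg; under eq_fun do rewrite -mulrA; exact/u1P/u2P.
Qed.

Lemma cm_mult1 : cm_mult (fun=> 1).
Proof. by split => // g cg; under eq_fun do rewrite mul1r. Qed.

Lemma cm_mult_cst (a : R) : cm_mult (fun=> a).
Proof. by have := cm_multZ a cm_mult1; under eq_fun do rewrite mulr1. Qed.

Lemma cm_multB u1 u2 : cm_mult u1 -> cm_mult u2 -> cm_mult (fun y => u1 y - u2 y).
Proof.
move=> c1 /(cm_multZ (-1)) c2; have := cm_multD c1 c2.
by under eq_fun do rewrite mulN1r.
Qed.

(** Up to the null set of [noise_linear], this factor turns the weight vector v into v + c w. *)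
Lemma cm_mult_expR (c : R) w : cm_mult (fun y => expR (c * y w)).
Proof.
have me : measurable_fun setT (fun y : T => expR (c * y w)).
  apply: measurableT_comp => //; apply: measurable_funM => //.
  exact: measurable_coord.
split=> // g [mg gP]; have meg := measurable_funM me mg.
split => // v; have [x x1 x2] := gP (v + c *: w); exists x.
- apply: has_integral_ae x1; first by apply: measurable_funM => //;
    exact: (measurableT_comp meg measurable_shifted_path).
  have := noise_linear xi_noise v w c; apply: filterS => o e.
  rewrite /W1 e [RHS]mulrAC -expRD mulrC; congr (expR _ * _).
  by rewrite innerDr innerZr /shifted_path; ring.
- apply: has_integral_ae x2; first by apply: measurable_funM => //;
    exact: (measurableT_comp meg measurable_noise_path).
  have := noise_linear xi_noise v w c; apply: filterS => o e.
  rewrite /W2 e [RHS]mulrAC -expRD mulrC; congr (expR _ * _).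
  by rewrite /noise_path; ring.
Qed.

(** Dominated convergence on both sides; the exponential bound is admissible because exponentials of
    coordinates are already multipliers. The two sequences of integrals coincide, hence so do their
    limits. *)
Lemma cm_mult_cvg (u_ : nat -> T -> R) u (C c : R) w :
  (forall n, cm_mult (u_ n)) -> (forall y, u_ n y @[n --> \oo] --> u y) ->
  (forall n y, `|u_ n y| <= C * (expR (c * y w) + expR (- c * y w))) ->
  cm_mult u.
Proof.
move=> um uu ub.
have mu : measurable_fun setT u.
  by apply: (@measurable_fun_cvg _ _ _ _ u_ u (fun n => (um n).1)) => y _; exact: uu.
split=> // g cg; split; first by apply: measurable_funM => //; case: cg.
move=> v.
have /choice[x xP] : forall n, exists x,
    has_integral P (fun o => u_ n (shifted_path o) * g (shifted_path o) * W1 v o) x /\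
    has_integral P (fun o => u_ n (noise_path o) * g (noise_path o) * W2 v o) x.
  by move=> n; have [_ /(_ v)[x x1 x2]] := (um n).2 _ cg; exists x.
(* One argument for both sides: [X] and [W] stand for the shifted path with [W1] and for the
   unshifted one with [W2]. *)
have dom (X : Omega -> T) (W : Omega -> R) :
    (forall o, 0 < W o) ->
    (forall c', exists x, has_integral P (fun o => expR (c' * X o w) * g (X o) * W o) x) ->
    (forall n, has_integral P (fun o => u_ n (X o) * g (X o) * W o) (x n)) ->
    exists2 z, has_integral P (fun o => u (X o) * g (X o) * W o) z & x n @[n --> \oo] --> z.
  move=> W0 XI iu; have [x1 h1] := XI c; have [x2 h2] := XI (- c).
  have [y1 [g1 k1]] : exists y, has_integral P
      (fun o => `|expR (c * X o w) * g (X o) * W o|) y.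
    by apply: integrable_has_integral; have := integrable_norm h1.1.
  have [y2 [g2 k2]] : exists y, has_integral P
      (fun o => `|expR (- c * X o w) * g (X o) * W o|) y.
    by apply: integrable_has_integral; have := integrable_norm h2.1.
  apply: (has_integral_cvg iu (g := fun o => C * (`|expR (c * X o w) * g (X o) * W o| +
    `|expR (- c * X o w) * g (X o) * W o|)) (y := C * (y1 + y2))).
  - by move=> o; do 2 (apply: cvgM; last exact: cvg_cst); exact: uu.
  - move=> n o; rewrite !normrM !(gtr0_norm (expR_gt0 _)) (gtr0_norm (W0 _)).
    by rewrite -!mulrDl !mulrA !ler_wpM2r// ltW.
  - by apply: has_integralZ; apply: has_integralD.
have [c'|z1 hz1 c1] := dom shifted_path (W1 v) (fun=> expR_gt0 _) _ (fun n => (xP n).1).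
  by have [_ /(_ v)[x' x1 _]] := (cm_mult_expR c' w).2 _ cg; exists x'.
have [c'|z2 hz2 c2] := dom noise_path (W2 v) (fun=> expR_gt0 _) _ (fun n => (xP n).2).
  by have [_ /(_ v)[x' _ x2]] := (cm_mult_expR c' w).2 _ cg; exists x'.
exists z1 => //; suff -> : z1 = z2 by [].
exact: (cvg_unique _ c1 c2).
Qed.

Lemma cm_mult_bounded_cvg (u_ : nat -> T -> R) u :
  (forall n, cm_mult (u_ n)) -> (forall y, u_ n y @[n --> \oo] --> u y) ->
  (forall n y, `|u_ n y| <= 1) -> cm_mult u.
Proof.
move=> um uu ub; apply: (cm_mult_cvg (C := 1) (c := 0) (w := 0) um uu) => n y.
by rewrite oppr0 mul0r expR0 mul1r (le_trans (ub n y))// lerDl.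
Qed.

(** A coordinate is the derivative at k = 0 of e^{k y(w)}, a limit of difference quotients with an
    exponential bound. *)
Lemma cm_mult_coord w : cm_mult (fun y => y w).
Proof.
pose k (n : nat) : R := n.+1%:R^-1.
have kP n : 0 < k n <= 1.
  by rewrite /k invr_gt0 ltr0n/= invf_le1 ?ltr0n// ler1n.
apply: (@cm_mult_cvg (fun n y => (k n)^-1 * (expR (k n * y w) - 1)) _ 1 2 w).
- move=> n; apply: cm_multZ; apply: cm_multB; last exact: cm_mult1.
  exact: cm_mult_expR.
- move=> y; under eq_fun do rewrite mulrC.
  by apply: cvg_expR_diff => //; exact: cvg_harmonic.
- by move=> n y; rewrite mul1r mulrC mulNr; exact: expR_diff_bound.
Qed.

Lemma cm_multX u n : cm_mult u -> cm_mult (fun y => u y ^+ n).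
Proof.
move=> cu; elim: n => [|n IH].
  by under eq_fun do rewrite expr0; exact: cm_mult1.
by under eq_fun do rewrite exprS; exact: cm_multM.
Qed.

(** Partial sums of the sine series are polynomials in a coordinate, dominated by e^{|b|} e^{|a
    y(w)|}. *)
Lemma cm_mult_sin (a b : R) w : cm_mult (fun y => sin (a * y w + b)).
Proof.
apply: (@cm_mult_cvg (fun n y => series (sin_coeff (a * y w + b)) n) _ (expR `|b|) a w).
- elim=> [|n IH].
    under eq_fun do rewrite /series/= big_geq//.
    exact: cm_mult_cst.
  under eq_fun do rewrite seriesSr /sin_coeff/= mulrAC.
  apply: cm_multD => //; apply: cm_multZ; apply: cm_multX.
  by apply: cm_multD; [apply: cm_multZ; exact: cm_mult_coord|exact: cm_mult_cst].
- by move=> y; rewrite unlock; exact: is_cvg_series_sin_coeff.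
- move=> n y; rewrite (le_trans (series_sin_coeff_bound _ _))//.
  rewrite (le_trans (_ : _ <= expR `|b| * expR `|a * y w|))//.
    by rewrite -expRD ler_expR addrC ler_normD.
  by rewrite ler_wpM2l ?expR_ge0// mulNr expR_normr_le.
Qed.

Definition cm_set (B : set T) := measurable B /\ cm_mult (\1_B).

(** Two bounded limits: [smoothstep] is iterated on a rescaled sine, then the period of the sine
    tends to infinity. *)
Lemma cm_set_ray (b : R) w : cm_set [set y | b < y w].
Proof.
have mB : measurable ([set y | b < y w] : set T).
  apply: sub_sigma_algebra; exists w, `]b, +oo[%classic; split => //.
  by apply/seteqP; split => y /=; rewrite in_itv/= andbT.
split=> //.
pose U (n : nat) (y : T) := (1 + sin (n.+1%:R^-1 * (y w - b))) / 2.
have U01 n y : 0 <= U n y <= 1.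
  rewrite /U; have := sin_geN1 (n.+1%:R^-1 * (y w - b)).
  by have := sin_le1 (n.+1%:R^-1 * (y w - b)); lra.
have cU n : cm_mult (U n).
  rewrite /U; under eq_fun do rewrite mulrC mulrBr.
  apply: cm_multZ; apply: cm_multD; first exact: cm_mult_cst.
  exact: cm_mult_sin.
have iU m n : cm_mult (fun y => iter m smoothstep (U n y)).
  elim: m => [|m IH]/=; first exact: cU.
  rewrite /smoothstep; apply: cm_multM => //; apply: cm_multM => //.
  by apply: cm_multB; [exact: cm_mult_cst|exact: cm_multZ].
have hU n : cm_mult (fun y => half_step (U n y)).
  apply: (cm_mult_bounded_cvg (iU^~ n)) => [y|m y].
    exact: iter_smoothstep_cvg.
  have /andP[i0 i1] := iter_smoothstep_itv m (U01 n y).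
  by rewrite ger0_norm.
pose k (y : T) : R := if y w - b < 0 then 0 else if y w - b == 0 then 2^-1 else 1.
have ck : cm_mult k.
  apply: (cm_mult_bounded_cvg hU) => [y|n y].
    exact: half_step_sin_cvg.
  rewrite /half_step; case: ifP => _; first by rewrite normr0.
  by case: ifP => _; rewrite ger0_norm//; lra.
(* The limit [k] has the value 1/2 on the boundary; 2t² - t sends 0, 1/2, 1 to 0, 0, 1. *)
have -> : \1_[set y | b < y w] = (fun y => 2 * (k y * k y) - k y).
  apply/funext => y; rewrite indicE /k; case: (ltgtP b (y w)) => by_.
  - rewrite mem_set// subr_lt0 subr_eq0 (gt_eqF by_) ltNge (ltW by_)/=; ring.
  - rewrite memNset/=; last by apply/negP; rewrite -leNgt ltW.
    by rewrite subr_lt0 by_; ring.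
  - rewrite memNset/=; last by rewrite by_ ltxx.
    by rewrite by_ subrr ltxx eqxx; field.
by apply: cm_multB => //; apply: cm_multZ; exact: cm_multM.
Qed.

Lemma cm_set0 : cm_set set0.
Proof.
split => //; rewrite (_ : \1_set0 = (fun=> 0)); first exact: cm_mult_cst.
by apply/funext => y; rewrite indic0.
Qed.

Lemma cm_setC B : cm_set B -> cm_set (~` B).
Proof.
move=> [mB cB]; split; first exact: measurableC.
have -> : \1_(~` B) = (fun y : T => 1 - \1_B y :> R).
  by apply/funext => y; rewrite !indicE in_setC; case: (y \in B); rewrite ?subr0 ?subrr.
by apply: cm_multB => //; exact: cm_mult1.
Qed.

Lemma cm_setI A B : cm_set A -> cm_set B -> cm_set (A `&` B).
Proof.
move=> [mA cA] [mB cB]; split; first exact: measurableI.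
have -> : \1_(A `&` B) = (fun y : T => \1_A y * \1_B y :> R).
  by apply/funext => y; rewrite indicI.
exact: cm_multM.
Qed.

(** Finite unions follow from complements and intersections by De Morgan; the countable union is a
    bounded limit of their indicators. *)
Lemma cm_set_bigcup (F : nat -> set T) : (forall i, cm_set (F i)) ->
  cm_set (\bigcup_i F i).
Proof.
move=> cF; split; first by apply: bigcup_measurable => i _; case: (cF i).
have cU n : cm_set (\big[setU/set0]_(i < n) F i).
  elim: n => [|n IH].
    by rewrite big_ord0; exact: cm_set0.
  rewrite big_ord_recr/= -[X in cm_set X]setCK setCU.
  by apply: cm_setC; apply: cm_setI; exact: cm_setC.
apply: (@cm_mult_bounded_cvg (fun n => \1_(\big[setU/set0]_(i < n) F i))).
- by move=> n; case: (cU n).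
- move=> y; have [[i _ Fiy]|nF] := pselect ((\bigcup_i F i) y).
    apply: cvg_near_cst; exists i.+1 => // n /= ni.
    rewrite !indicE !mem_set//; first by exists i.
    by rewrite -bigcup_mkord; exists i.
  apply: cvg_near_cst; apply: nearW => n /=.
  rewrite !indicE !memNset// -bigcup_mkord => -[i _ Fiy].
  by apply: nF; exists i.
- by move=> n y; rewrite indicE; case: (_ \in _); rewrite ?normr1// normr0.
Qed.

Lemma cm_set_measurable (B : set T) : measurable B -> cm_set B.
Proof.
apply: smallest_sub; first split.
- exact: cm_set0.
- by move=> C cC; rewrite setTD; exact: cm_setC.
- by move=> F cF; exact: cm_set_bigcup.
move=> _ [w [D [mD ->]]].
(* The base of a cylinder is any Borel set; a second generation argument reduces it to open rays. *)
have : (@RGenOInfty.G R).-sigma.-measurable D by rewrite -RGenOInfty.measurableE.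
apply: (@smallest_sub _ _ _ [set D | cm_set [set y | D (y w)]]); first split => /=.
- exact: cm_set0.
- move=> C cC; rewrite (_ : [set y | _] = ~` [set y : T | C (y w)]).
    exact: cm_setC.
  by apply/seteqP; split => y //= [].
- move=> F cF; rewrite (_ : [set y | _] = \bigcup_i [set y : T | F i (y w)]).
    exact: cm_set_bigcup.
  by [].
- move=> _ [b ->] /=; rewrite (_ : [set y | _] = [set y : T | b < y w]).
    exact: cm_set_ray.
  by apply/seteqP; split => y /=; rewrite in_itv/= andbT.
Qed.

Theorem cameron_martin (B : set T) : measurable B ->
  P [set o | B (shifted_path o)] =
  (\int[P]_o (\1_B (noise_path o) * expR (xi h o - `|h| ^+ 2 / 2))%:E)%E.
Proof.
move=> mB; have [_ cB] := cm_set_measurable mB.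
have [_ /(_ 0)[x x1 x2]] := cB.2 _ cm_class1.
have xi0 : {ae P, forall o, xi 0 o = 0}.
  have := noise_linear xi_noise 0 0 (-1); rewrite scaler0 addr0.
  by apply: filterS => o; rewrite mulN1r subrr.
have mB1 : measurable [set o | B (shifted_path o)].
  by rewrite -[X in measurable X]setTI; exact: measurable_shifted_path.
transitivity (x%:E).
  rewrite -[in LHS](setIT [set o | B (shifted_path o)]) -integral_indic//.
  suff [] : has_integral P \1_[set o | B (shifted_path o)] x by [].
  apply: has_integral_ae x1 => //.
  apply: filterS xi0 => o xi0; rewrite /W1 xi0 inner0r addr0 expR0 !mulr1.
  by rewrite !indicE.
suff [_ ->] : has_integral P (fun o =>
  \1_B (noise_path o) * expR (xi h o - `|h| ^+ 2 / 2)) x by [].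
apply: has_integral_ae x2.
  apply: measurable_funM.
    by apply: (measurableT_comp _ measurable_noise_path); exact: measurable_indic.
  by apply: measurableT_comp => //; exact: measurable_funB.
by apply: filterS xi0 => o xi0; rewrite /W2 xi0 add0r mulr1.
Qed.

End cameron_martin.

(** * Chi-square exponential moments and tails *)

Section noise_chi_square.
Context (R : realType) (d : measure_display) (Omega : measurableType d).
Context (P : probability Omega R) (G : hilbertType R) (xi : G -> {RV P >-> R}).
Hypothesis xi_noise : white_noise xi.
Variable e : nat -> G.

(* The square in the exponent is linearised by e^{x²/4} = ∫ e^{t x/√2} dN(0,1)(t). *)
Lemma noise_chi_square_mgf k v :
  (forall i l, (i < k)%N -> (l < k)%N -> inner (e i) (e l) = (i == l)%:R) ->
  (forall i, (i < k)%N -> inner v (e i) = 0) ->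
  (\int[P]_o (expR (xi v o + \sum_(i < k) xi (e i) o ^+ 2 / 4))%:E =
   (Num.sqrt 2 ^+ k * expR (`|v| ^+ 2 / 2))%:E)%E.
Proof.
elim: k v => [|k IH] v oe ve.
  under eq_integral do rewrite big_ord0 addr0.
  by rewrite (noise_mgf xi_noise v).2 expr0 mul1r.
have oek i l : (i < k)%N -> (l < k)%N -> inner (e i) (e l) = (i == l)%:R.
  by move=> ik lk; rewrite oe// ltnS ltnW.
(* With this scaling the Laplace transform of N(0,1) at a ξ(e_k) is e^{ξ(e_k)²/4}. *)
pose a : R := (Num.sqrt 2)^-1.
have a2 : a ^+ 2 = 2^-1 by rewrite /a exprVn sqr_sqrtr.
pose N : probability (measurableTypeR R) R := normal_prob 0 1.
pose F (z : Omega * measurableTypeR R) := (expR (xi v z.1 + z.2 * (a * xi (e k) z.1) +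
  \sum_(i < k) xi (e i) z.1 ^+ 2 / 4))%:E.
have mxi w : measurable_fun setT (fun z : Omega * measurableTypeR R => xi w z.1).
  by apply: (measurableT_comp (measurable_funPT (xi w))); exact: measurable_fst.
have mF : measurable_fun setT F.
  apply/measurable_EFinP; apply: measurableT_comp => //.
  apply: measurable_funD.
    apply: measurable_funD => //; apply: measurable_funM.
      exact: (@measurable_snd _ _ Omega (measurableTypeR R)).
    exact: measurable_funM.
  apply: measurable_sum => i; apply: measurable_funM => //.
  exact: measurable_funX.
have F0 z : (0 <= F z)%E by rewrite lee_fin expR_ge0.
transitivity (\int[P]_o \int[N]_t F (o, t))%E.
  apply: eq_integral => o _; rewrite big_ord_recr/=.
  under eq_integral => t _ do rewrite /F/= addrAC expRD (mulrC _ (a * _)) EFinM.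
  rewrite ge0_integralZl//; last first.
    by apply/measurable_EFinP; apply: measurableT_comp => //;
      exact: (@measurable_funM _ (measurableTypeR R)).
  rewrite normal_mgf// mulr0 add0r expr1n mul1r -EFinM -expRD; congr (expR _)%:E.
  by rewrite exprMn a2; field.
rewrite (fubini_tonelli F mF F0)//.
transitivity (\int[N]_t ((Num.sqrt 2 ^+ k * expR (`|v| ^+ 2 / 2))%:E *
    (expR (t ^+ 2 / 4))%:E))%E; last first.
  rewrite ge0_integralZl//; last first.
    by apply/measurable_EFinP; apply: measurableT_comp => //;
      apply: (@measurable_funM _ (measurableTypeR R)) => //; exact: measurable_funX.
  by rewrite normal_expR_sqr -EFinM; congr EFin; rewrite mulrAC -exprSr.
apply: eq_integral => t _.
(* After the exchange of integrals the linear term is absorbed in v; the new vector is still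
   orthogonal to e_i for i < k, and its squared norm exceeds that of v by t²/2. *)
have /IH : forall i, (i < k)%N -> inner (v + (t * a) *: e k) (e i) = 0.
  move=> i ik; rewrite innerDl innerZl ve ?oe// ?ltnS ?(ltnW ik)// gtn_eqF//.
  by rewrite mulr0 addr0.
move=> /(_ oek); rewrite normDsqr innerZr ve// !mulr0 addr0.
rewrite normrZ exprMn -[`|e k| ^+ 2]inner_norm oe// eqxx mulr1 real_normK ?num_real//.
rewrite exprMn a2 mulrDl expRD mulrA => E.
transitivity (\int[P]_o (expR (xi (v + (t * a) *: e k) o +
    \sum_(i < k) xi (e i) o ^+ 2 / 4))%:E)%E.
  apply: ae_eq_integral => //.
  - apply/measurable_EFinP; apply: measurableT_comp => //.
    apply: measurable_funD; first by apply: measurable_funD => //;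
      apply: measurable_funM => //; exact: measurable_funM.
    by apply: measurable_sum => i; apply: measurable_funM => //; exact: measurable_funX.
  - apply/measurable_EFinP; apply: measurableT_comp => //.
    apply: measurable_funD => //.
    by apply: measurable_sum => i; apply: measurable_funM => //; exact: measurable_funX.
  - have := noise_linear xi_noise v (e k) (t * a); apply: filterS => o -> _.
    by rewrite /F/= mulrA.
by rewrite E -EFinM; congr (_ * expR _)%:E; field.
Qed.

(** Markov's inequality for e^{N/4}, N the sum of squares, whose mean 2^{k/2} is at most e^k. *)
Lemma noise_chi_square_tail k (s : R) :
  (forall i l, (i < k)%N -> (l < k)%N -> inner (e i) (e l) = (i == l)%:R) ->
  (P [set o | (4 * s < \sum_(i < k) xi (e i) o ^+ 2)%R] <= (expR (k%:R - s))%:E)%E.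
Proof.
move=> oe; pose N o := \sum_(i < k) xi (e i) o ^+ 2.
have mN : measurable_fun setT N.
  by apply: measurable_sum => i; exact: measurable_funX.
have mS : measurable [set o | 4 * s < N o].
  rewrite (_ : [set o | _] = setT `&` N @^-1` `]4 * s, +oo[).
    by apply: mN => //; exact: measurable_itv.
  by apply/seteqP; split => o /=; rewrite in_itv/= andbT; [move=> ?; split|case].
have mgf : (\int[P]_o (expR (N o / 4))%:E = (Num.sqrt 2 ^+ k)%:E)%E.
  have := noise_chi_square_mgf oe (v := 0) (fun i _ => inner0l _).
  rewrite normr0 expr0n/= mul0r expR0 mulr1 => <-.
  have xi0 : {ae P, forall o, xi 0 o = 0}.
    have := noise_linear xi_noise 0 0 (-1); rewrite scaler0 addr0.
    by apply: filterS => o; rewrite mulN1r subrr.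
  apply: ae_eq_integral => //.
  - by apply/measurable_EFinP; apply: measurableT_comp => //; exact: measurable_funM.
  - apply/measurable_EFinP; apply: measurableT_comp => //.
    apply: measurable_funD => //.
    by apply: measurable_sum => i; apply: measurable_funM => //; exact: measurable_funX.
  - by apply: filterS xi0 => o -> _; rewrite add0r /N mulr_suml.
have : (\int[P]_o ((expR s)%:E * (\1_[set o | (4 * s < N o)%R] o)%:E) <=
        \int[P]_o (expR (N o / 4))%:E)%E.
  apply: ge0_le_integral => //.
  - by apply/measurable_EFinP; exact: measurable_funM.
  - by apply/measurable_EFinP; apply: measurableT_comp => //; exact: measurable_funM.
  - move=> o _; rewrite -EFinM lee_fin indicE; case: (boolP (_ \in _)).
      by rewrite inE/= mulr1 ler_expR => ?; lra.
    by rewrite mulr0 expR_ge0.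
rewrite mgf ge0_integralZl//; last exact/measurable_EFinP.
rewrite integral_indic// setIT muleC -lee_pdivlMr ?expR_gt0// => /le_trans; apply.
rewrite -EFinM lee_fin expRD -expRN ler_wpM2r ?expR_ge0//.
have -> : expR (k%:R : R) = expR 1 ^+ k by rewrite -expRM_natl mulr1.
rewrite lerXn2r ?nnegrE ?sqrtr_ge0 ?expR_ge0//.
rewrite (@le_trans _ _ 2)//; last by have := expR_ge1Dx (1 : R); lra.
rewrite -[leRHS]ger0_norm// -sqrtr_sqr ler_wsqrtr//; lra.
Qed.

End noise_chi_square.

(** * Posterior concentration *)

(** Settles the degenerate quotients: D = 0 forces N = 0, and D = +oo has inverse 0, so the quotient
    is 0 in both cases. *)
Lemma posterior_gtE {R : realType} (e : R) (N D : \bar R) :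
  0 < e -> (0 <= N)%E -> (N <= D)%E ->
  (e%:E < N / D)%E = (D < +oo)%E && (e%:E * D < N)%E.
Proof.
move=> e0; case: D => [z| |]; last by move=> /le_trans h /h.
- rewrite ltry/=; case: N => [x| |]//; rewrite !lee_fin => x0 xz.
  rewrite inver; case: eqP => [z0|zn0].
    have -> : x = 0 by apply/le_anti; rewrite x0 -z0 xz.
    by rewrite mul0e z0 mule0 ltxx lte_fin ltNge ltW.
  have z0 : 0 < z by rewrite lt_def (le_trans x0 xz) andbT; exact/eqP.
  by rewrite -!EFinM !lte_fin ltr_pdivlMr.
- by move=> _ _; rewrite invey mule0 ltxx lte_fin ltNge ltW.
Qed.

Section posterior_concentration.
Context (R : realType) (dE dY : measure_display).
Context (E : measurableType dE) (Y : measurableType dY).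
Variables (mu : probability Y R) (law : E -> probability Y R) (p : E -> Y -> R).
Variable Pi : probability E R.
Hypothesis p_ge0 : forall f y, 0 <= p f y.
Hypothesis mp : measurable_fun setT (fun fy : E * Y => p fy.1 fy.2).
Hypothesis lawE : forall f B, measurable B ->
  law f B = (\int[mu]_(y in B) (p f y)%:E)%E.

Definition evidence (B : set E) (y : Y) : \bar R := (\int[Pi]_(f in B) (p f y)%:E)%E.

Let mpf f : measurable_fun setT (p f).
Proof. exact: (measurableT_comp mp (measurable_pair1 f)). Qed.

Let mpy y : measurable_fun setT (p ^~ y).
Proof. exact: (measurableT_comp mp (measurable_pair2 y)). Qed.

Let pB B C (fy : E * Y) := (p fy.1 fy.2 * \1_B fy.1 * \1_C fy.2)%:E.

Let mpB B C : measurable B -> measurable C -> measurable_fun setT (pB B C).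
Proof.
move=> mB mC; apply/measurable_EFinP; apply: measurable_funM.
  by apply: measurable_funM => //; apply: (measurableT_comp _ measurable_fst);
    exact: measurable_indic.
by apply: (measurableT_comp _ measurable_snd); exact: measurable_indic.
Qed.

Let pB_ge0 B C z : (0 <= pB B C z)%E.
Proof. by rewrite lee_fin !mulr_ge0. Qed.

Let evidenceE B C y : measurable B -> measurable C ->
  (\int[Pi]_f pB B C (f, y) = evidence B y * (\1_C y)%:E)%E.
Proof.
move=> mB mC; rewrite /evidence [in RHS]integral_mkcond.
transitivity (\int[Pi]_f ((p f y * \1_B f)%:E * (\1_C y)%:E))%E.
  by apply: eq_integral => f _; rewrite /pB -EFinM.
rewrite ge0_integralZr//; last 2 first.
- by apply/measurable_EFinP; apply: measurable_funM => //; exact: measurable_indic.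
- by move=> f _; rewrite lee_fin mulr_ge0.
congr (_ * _)%E; apply: eq_integral => f _.
by rewrite patchE indicE; case: ifP => _; rewrite ?mulr1// mulr0.
Qed.

Let law_slice B C f : measurable B -> measurable C ->
  (\int[mu]_y pB B C (f, y) = law f C * (\1_B f)%:E)%E.
Proof.
move=> mB mC; rewrite lawE// [in RHS]integral_mkcond.
transitivity (\int[mu]_y ((p f y * \1_C y)%:E * (\1_B f)%:E))%E.
  by apply: eq_integral => y _; rewrite /pB -EFinM mulrAC.
rewrite ge0_integralZr//; last 2 first.
- by apply/measurable_EFinP; apply: measurable_funM => //; exact: measurable_indic.
- by move=> y _; rewrite lee_fin mulr_ge0.
congr (_ * _)%E; apply: eq_integral => y _.
by rewrite patchE indicE; case: ifP => _; rewrite ?mulr1// mulr0.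
Qed.

Lemma measurable_evidence B : measurable B -> measurable_fun setT (evidence B).
Proof.
move=> mB; have := measurable_fun_fubini_tonelli_G (m1 := Pi) (pB B setT)
  (mpB mB measurableT) (pB_ge0 B setT).
apply: eq_measurable_fun => y _.
by rewrite /fubini_G evidenceE// indicE in_setT mule1.
Qed.

Lemma evidence_ge0 B y : (0 <= evidence B y)%E.
Proof. by apply: integral_ge0 => f _; rewrite lee_fin. Qed.

Lemma measurable_law C : measurable C -> measurable_fun setT (fun f => law f C).
Proof.
move=> mC; have := measurable_fun_fubini_tonelli_F (m2 := mu) (pB setT C)
  (mpB measurableT mC) (pB_ge0 setT C).
apply: eq_measurable_fun => f _.
by rewrite /fubini_F law_slice// indicE in_setT mule1.
Qed.

Lemma integral_evidence B C : measurable B -> measurable C ->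
  (\int[mu]_(y in C) evidence B y = \int[Pi]_(f in B) law f C)%E.
Proof.
move=> mB mC; have := fubini_tonelli (m1 := Pi) (m2 := mu) (pB B C) (mpB mB mC) (pB_ge0 B C).
under eq_integral do rewrite law_slice//.
under [X in _ = X -> _]eq_integral do rewrite evidenceE//.
move=> e; rewrite integral_mkcond [RHS]integral_mkcond.
transitivity (\int[mu]_y (evidence B y * (\1_C y)%:E))%E.
  apply: eq_integral => y _; rewrite patchE indicE.
  by case: ifP => _; rewrite ?mule1// mule0.
rewrite -e; apply: eq_integral => f _; rewrite patchE indicE.
by case: ifP => _; rewrite ?mule1// mule0.
Qed.

Let measurable_ge (g1 g2 : Y -> \bar R) : measurable_fun setT g1 -> measurable_fun setT g2 ->
  measurable [set y | (g1 y <= g2 y)%E].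
Proof. by move=> m1 m2; rewrite -[X in measurable X]setTI; exact: measurable_lee. Qed.

Let measurable_gt (g1 g2 : Y -> \bar R) : measurable_fun setT g1 -> measurable_fun setT g2 ->
  measurable [set y | (g1 y < g2 y)%E].
Proof. by move=> m1 m2; rewrite -[X in measurable X]setTI; exact: measurable_lte. Qed.

Let mZp (k : R) f : measurable_fun setT (fun y => (k * p f y)%:E).
Proof. by apply/measurable_EFinP; exact: measurable_funM. Qed.

Lemma measurable_evidence_ge B (k : R) f0 : measurable B ->
  measurable [set y | ((k * p f0 y)%:E <= evidence B y)%E].
Proof. by move=> mB; apply: measurable_ge => //; exact: measurable_evidence. Qed.

Lemma measurable_evidence_lt B (k : R) f0 : measurable B ->
  measurable [set y | (evidence B y < (k * p f0 y)%:E)%E].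
Proof. by move=> mB; apply: measurable_gt => //; exact: measurable_evidence. Qed.

Let integral_Zp (k : R) f C : 0 <= k -> measurable C ->
  (\int[mu]_(y in C) (k * p f y)%:E = k%:E * law f C)%E.
Proof.
move=> k0 mC; rewrite lawE//; under eq_integral do rewrite EFinM.
rewrite ge0_integralZl//.
- by apply: measurable_funTS; exact/measurable_EFinP.
- by move=> y _; rewrite lee_fin.
Qed.

(** Markov's inequality under f0: the density turns the law under f0 into an integral over [mu], the
    event bounds it by the evidence, and Tonelli's theorem leaves the error of [Psi] averaged over
    [B]. *)
Lemma evidence_markov B Psi (k t : R) f0 : measurable B -> measurable Psi -> 0 < k ->
  (forall f, B f -> (law f Psi <= t%:E)%E) ->
  (k%:E * law f0 (Psi `&` [set y | ((k * p f0 y)%:E <= evidence B y)%E]) <=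
   t%:E * Pi B)%E.
Proof.
move=> mB mPsi k0 tP.
have mC : measurable (Psi `&` [set y | ((k * p f0 y)%:E <= evidence B y)%E]).
  by apply: measurableI => //; exact: measurable_evidence_ge.
rewrite -integral_Zp ?(ltW k0)//.
apply: (@le_trans _ _ (\int[mu]_(y in Psi `&` [set y | ((k * p f0 y)%:E <= evidence B y)%E])
    evidence B y)%E).
  apply: ge0_le_integral => //.
  - by move=> y _; rewrite lee_fin mulr_ge0// ltW.
  - exact: measurable_funTS.
  - by apply: measurable_funTS; exact: measurable_evidence.
  - by move=> y [].
rewrite integral_evidence// -integral_cst//.
apply: ge0_le_integral => //.
- by apply: measurable_funTS; exact: measurable_law.
- move=> f Bf; apply: le_trans (tP f Bf); apply: le_measure; rewrite ?inE//.
Qed.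

(** The mass of the bad event C under f0 is compared with its mass under each f in B; averaged over
    B, the latter is the integral of the evidence over C, which is small by the choice of C. *)
Lemma evidence_lower B (a t : R) f0 : measurable B -> 0 < a -> (0 < Pi B)%E -> 0 <= t ->
  (forall f, B f -> (law f0 [set y | (p f y < 2 * a * p f0 y)%R] <= t%:E)%E) ->
  (law f0 [set y | (evidence B y < ((a * fine (Pi B)) * p f0 y)%:E)%E] <= (2 * t)%:E)%E.
Proof.
move=> mB a0 PiB t0 tP.
set C := [set y | _]; have mC : measurable C by exact: measurable_evidence_lt.
have PiBfin : (Pi B \is a fin_num) by exact: fin_num_measure.
set b := fine (Pi B); have b0 : 0 < b by apply: fine_gt0; rewrite PiB ltey_eq PiBfin.
have bE : Pi B = b%:E by rewrite /b fineK.
have lC : law f0 C \is a fin_num by exact: fin_num_measure.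
set l := fine (law f0 C); have lE : law f0 C = l%:E by rewrite /l fineK.
(* Split C according to whether p_f >= 2a p_f0: where this holds, 2a times the mass under f0 is at
   most the mass under f; the rest has mass at most t. *)
have pointwise f : B f -> ((2 * a * l)%:E <= law f C + (2 * a * t)%:E)%E.
  move=> Bf; pose N := [set y | (p f y < 2 * a * p f0 y)%R].
  have mN : measurable N.
    by apply: measurable_set_ltr => //; exact: measurable_funM.
  have -> : (2 * a * l)%:E = ((2 * a)%:E * law f0 (C `\` N) + (2 * a)%:E * law f0 (C `&` N))%E.
    rewrite -muleDr//; last by apply: ge0_adde_def; rewrite inE.
    by rewrite EFinM -lE (measureDI _ mC mN).
  apply: leeD.
    rewrite -integral_Zp ?mulr_ge0 ?(ltW a0)//; last exact: measurableD.
    apply: (@le_trans _ _ (law f (C `\` N))).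
      rewrite lawE; last exact: measurableD.
      apply: ge0_le_integral => //.
      - exact: measurableD.
      - by move=> y _; rewrite lee_fin !mulr_ge0// ltW.
      - exact: measurable_funTS.
      - by apply: measurable_funTS; exact/measurable_EFinP.
      - by move=> y [_ /negP]; rewrite -leNgt lee_fin.
    by apply: le_measure; rewrite ?inE//; exact: measurableD.
  rewrite [(2 * a * t)%:E]EFinM lee_pmul2l ?lte_fin ?mulr_gt0//; apply: le_trans (tP f Bf).
  by apply: le_measure; rewrite ?inE//; exact: measurableI.
have : ((2 * a * l * b)%:E <= \int[Pi]_(f in B) law f C + (2 * a * t * b)%:E)%E.
  rewrite [(2 * a * l * b)%:E]EFinM [(2 * a * t * b)%:E]EFinM -bE -!integral_cst//.
  rewrite -ge0_integralD//; last 2 first.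
  - by apply: measurable_funTS; exact: measurable_law.
  - by move=> f _; rewrite lee_fin !mulr_ge0// ltW.
  apply: ge0_le_integral => //.
  - by move=> f _; rewrite lee_fin !mulr_ge0// ?(ltW a0)// fine_ge0.
  - by apply: emeasurable_funD => //; apply: measurable_funTS; exact: measurable_law.
rewrite -integral_evidence// => h1.
have h2 : (\int[mu]_(y in C) evidence B y <= (a * b * l)%:E)%E.
  rewrite [(a * b * l)%:E]EFinM -lE -integral_Zp ?mulr_ge0 ?(ltW a0) ?(ltW b0)//.
  apply: ge0_le_integral => //.
  - by move=> y _; exact: evidence_ge0.
  - by apply: measurable_funTS; exact: measurable_evidence.
  - exact: measurable_funTS.
  - by move=> y /ltW.
have := le_trans h1 (leeD2r (2 * a * t * b)%:E h2).
rewrite lE -EFinD !lee_fin => h3.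
(* The gap between the thresholds 2a and a leaves abl <= 2abt. *)
have ab : 0 < a * b by rewrite mulr_gt0.
rewrite -(ler_pM2l ab); nra.
Qed.

Lemma evidence_mono A A' y : measurable A -> measurable A' -> A `<=` A' ->
  (evidence A y <= evidence A' y)%E.
Proof.
move=> mA mA' AA'; apply: ge0_subset_integral => //.
  by apply: measurable_funTS; exact/measurable_EFinP.
by move=> f _; rewrite lee_fin.
Qed.

(** Four bad events: a small denominator, rejection by the test, and a large numerator over [B1] or
    over [B2]. They contribute 8, 1, 2/e and 2/e times e^{-s}. *)
Lemma posterior_tail_bound B B0 B1 B2 Psi f0 (s e : R) :
  measurable B -> measurable B0 -> measurable B1 -> measurable B2 ->
  measurable Psi -> B `<=` B1 `|` B2 -> 0 <= s -> 0 < e ->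
  ((expR (- s))%:E <= Pi B0)%E ->
  (forall f, B0 f ->
    law f0 [set y | (p f y < 2 * expR (- (2 * s)) * p f0 y)%R] <= (4 * expR (- s))%:E)%E ->
  (Pi B1 <= (expR (- (4 * s)))%:E)%E ->
  (law f0 (~` Psi) <= (expR (- (4 * s)))%:E)%E ->
  (forall f, B2 f -> law f Psi <= (expR (- (4 * s)))%:E)%E ->
  (law f0 [set y | e%:E < evidence B y / evidence setT y] <=
   ((9 + 4 / e) * expR (- s))%:E)%E.
Proof.
move=> mB mB0 mB1 mB2 mPsi BB s0 e0 PB0 lB0 PB1 lPsi lB2.
(* Where the denominator is at least e^{-3s} p_f0, a posterior mass above e forces one of the two
   parts of the numerator to reach half of e times that bound. *)
pose k := e / 2 * expR (- (3 * s)).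
have k0 : 0 < k by rewrite mulr_gt0 ?expR_gt0// divr_gt0.
have Es : 0 < expR (- s) by exact: expR_gt0.
have Pi0 : (0 < Pi B0)%E by apply: lt_le_trans PB0; rewrite lte_fin.
set b := fine (Pi B0).
have bE : Pi B0 = b%:E by rewrite /b fineK//; exact: fin_num_measure.
pose C0 := [set y | (evidence B0 y < ((expR (- (2 * s)) * b) * p f0 y)%:E)%E].
(* On [B1] the prior mass alone is small, so the trivial test is used there. *)
pose C1 := setT `&` [set y | ((k * p f0 y)%:E <= evidence B1 y)%E].
pose C2 := Psi `&` [set y | ((k * p f0 y)%:E <= evidence B2 y)%E].
have mC0 : measurable C0 by exact: measurable_evidence_lt.
have mC1 : measurable C1 by apply: measurableI => //; exact: measurable_evidence_ge.
have mC2 : measurable C2 by apply: measurableI => //; exact: measurable_evidence_ge.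
have mPost : measurable [set y | (e%:E < evidence B y / evidence setT y)%E].
  rewrite (_ : [set y | _] = [set y | (evidence setT y < +oo)%E] `&`
      [set y | (e%:E * evidence setT y < evidence B y)%E]).
    apply: measurableI; apply: measurable_gt => //; try exact: measurable_evidence.
    by apply: measurable_funeM; exact: measurable_evidence.
  apply/seteqP; split => y /=; rewrite (posterior_gtE e0 (evidence_ge0 B y))//.
  - by move=> /andP[].
  - exact: evidence_mono.
  - by move=> [-> ->].
  - exact: evidence_mono.
have sub : [set y | (e%:E < evidence B y / evidence setT y)%E] `<=`
    C0 `|` ~` Psi `|` C1 `|` C2.
  move=> y /= post; apply: contrapT => nC.
  have nC0 : (((expR (- (2 * s)) * b) * p f0 y)%:E <= evidence B0 y)%E.
    by rewrite leNgt; apply/negP => yC0; apply: nC; left; left; left.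
  have Py : Psi y by apply: contrapT => nP; apply: nC; left; left; right.
  have nC1 : (evidence B1 y < (k * p f0 y)%:E)%E.
    by rewrite ltNge; apply/negP => yC1; apply: nC; left; right.
  have nC2 : (evidence B2 y < (k * p f0 y)%:E)%E.
    by rewrite ltNge; apply/negP => yC2; apply: nC; right.
  have eB : (evidence B y <= evidence B1 y + evidence B2 y)%E.
    apply: (le_trans (evidence_mono y mB (measurableU _ _ mB1 mB2) BB)).
    (* [B1] and [B2] may overlap; additivity needs a disjoint union. *)
    have -> : B1 `|` B2 = B1 `|` (B2 `\` B1).
      apply/seteqP; split => f; last by case=> [|[]]; [left|right].
      by have [|nB1] := pselect (B1 f); [left|case=> // B2f; right].
    rewrite /evidence ge0_integral_setU//.
    - rewrite leeD2l//; apply: evidence_mono => //; exact: measurableD.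
    - exact: measurableD.
    - by apply: measurable_funTS; exact/measurable_EFinP.
    - by move=> f _; rewrite lee_fin.
    - by apply/disj_setPS => f [B1f []].
  have eB0 := evidence_mono y mB0 measurableT (subsetT _).
  have eBT := evidence_mono y mB measurableT (subsetT _).
  have eB1 := evidence_ge0 B1 y; have eB2 := evidence_ge0 B2 y.
  have eB_ := evidence_ge0 B y.
  have p0 := p_ge0 f0 y.
  move: post; rewrite (posterior_gtE e0 eB_ eBT) => /andP[eTfin post].
  have ETf : evidence setT y \is a fin_num.
    by rewrite ge0_fin_numE//; exact: evidence_ge0.
  pose z := fine (evidence setT y); have zE : evidence setT y = z%:E by rewrite /z fineK.
  have h9 : expR (- (3 * s)) * p f0 y <= z.
    rewrite -lee_fin -zE; apply: le_trans eB0; apply: le_trans nC0.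
    rewrite lee_fin ler_wpM2r//.
    have -> : - (3 * s) = - (2 * s) + - s by ring.
    by rewrite expRD ler_wpM2l ?expR_ge0// -lee_fin -bE.
  have := lt_le_trans post eB; rewrite zE.
  move: nC1 nC2 eB1 eB2; case: (evidence B1 y) => [x1| |]//.
  case: (evidence B2 y) => [x2| |]//.
  rewrite -EFinD -EFinM !lte_fin => h1 h2 _ _ h3.
  have : e * (expR (- (3 * s)) * p f0 y) <= e * z by rewrite ler_pM2l.
  have : k * p f0 y = e * (expR (- (3 * s)) * p f0 y) / 2 by rewrite /k; field.
  by move=> E1 E2; rewrite E1 in h1 h2; lra.
(* The bound is the prior mass e^{-4s} divided by k; for [c2] it is the test error e^{-4s} divided
   by k. *)
have c1 : (law f0 C1 <= (2 / e * expR (- s))%:E)%E.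
  have := @evidence_markov B1 setT k 1 f0 mB1 measurableT k0.
  move=> /(_ (fun f _ => probability_le1 _ measurableT)).
  rewrite mul1e -lee_pdivlMl// => /le_trans; apply.
  apply: le_trans (lee_wpmul2l _ PB1) _; first by rewrite lee_fin invr_ge0 ltW.
  rewrite -EFinM lee_fin ler_pdivrMl// /k.
  have -> : - (4 * s) = - (3 * s) + - s by ring.
  by rewrite expRD le_eqVlt; apply/orP; left; apply/eqP; field; rewrite gt_eqF.
have c2 : (law f0 C2 <= (2 / e * expR (- s))%:E)%E.
  have := @evidence_markov B2 Psi k (expR (- (4 * s))) f0 mB2 mPsi k0 lB2.
  rewrite -lee_pdivlMl// => /le_trans; apply.
  apply: (@le_trans _ _ (k^-1%:E * (expR (- (4 * s)))%:E)%E).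
    rewrite lee_wpmul2l ?lee_fin ?invr_ge0 ?(ltW k0)//.
    by rewrite -[leRHS]mule1 lee_wpmul2l ?lee_fin ?expR_ge0//; exact: probability_le1.
  rewrite -EFinM lee_fin ler_pdivrMl// /k.
  have -> : - (4 * s) = - (3 * s) + - s by ring.
  by rewrite expRD le_eqVlt; apply/orP; left; apply/eqP; field; rewrite gt_eqF.
have c0 : (law f0 C0 <= (8 * expR (- s))%:E)%E.
  have := @evidence_lower B0 (expR (- (2 * s))) (4 * expR (- s)) f0 mB0 (expR_gt0 _) Pi0.
  rewrite mulr_ge0 ?expR_ge0// => /(_ isT lB0).
  by rewrite mulrA -natrM.
have c3 : (law f0 (~` Psi) <= (expR (- s))%:E)%E.
  by apply: le_trans lPsi _; rewrite lee_fin ler_expR; lra.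
have mCP : measurable (~` Psi) by exact: measurableC.
apply: (@le_trans _ _ (law f0 (C0 `|` ~` Psi `|` C1 `|` C2))).
  by apply: le_measure; rewrite ?inE//; do 3 ?apply: measurableU.
have -> : (9 + 4 / e) * expR (- s) =
    8 * expR (- s) + expR (- s) + 2 / e * expR (- s) + 2 / e * expR (- s).
  by field; rewrite gt_eqF.
rewrite !EFinD.
have mU1 : measurable (C0 `|` ~` Psi) by exact: measurableU.
have mU2 : measurable (C0 `|` ~` Psi `|` C1) by exact: measurableU.
apply: (le_trans (measureU2 _ mU2 mC2)); apply: leeD => //.
apply: (le_trans (measureU2 _ mU1 mC1)); apply: leeD => //.
by apply: (le_trans (measureU2 _ mC0 mCP)); apply: leeD.
Qed.

End posterior_concentration.

(** * Law of the observations and likelihood ratios *)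

Section observation_law.
Context (R : realType) (d : measure_display) (Omega : measurableType d).
Context (P : probability Omega R) (G : hilbertType R) (xi : G -> {RV P >-> R}).

Lemma measurable_observation n g : measurable_fun setT (observation xi n g).
Proof.
apply: measurable_path => w; apply: measurable_funD => //.
exact: measurable_funM.
Qed.

Definition observation_mfun n g : {mfun Omega >-> path_space R G} :=
  HB.pack (observation xi n g)
    (isMeasurableFun.Build _ _ _ _ _ (measurable_observation n g)).

Definition obs_prob n g : probability (path_space R G) R :=
  distribution P (observation_mfun n g).

Lemma obs_probE n g B : obs_prob n g B = P [set o | B (observation xi n g o)].
Proof. by []. Qed.

Hypothesis xi_noise : white_noise xi.

(** The densities [q] and [q0] are known only through integrals, so they are compared with the
    Cameron-Martin density through masses of sets. Markov's inequality handles the event where that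
    density exceeds 1/(4a). *)
Lemma likelihood_ratio_bound n (g g0 : G) (mu : probability (path_space R G) R)
    (q q0 : path_space R G -> R) (a : R) :
  (0 < n)%N -> 0 < a -> (forall y, 0 <= q y) -> (forall y, 0 <= q0 y) ->
  measurable_fun setT q -> measurable_fun setT q0 ->
  (forall B, measurable B -> obs_prob n g B = \int[mu]_(y in B) (q y)%:E)%E ->
  (forall B, measurable B -> obs_prob n g0 B = \int[mu]_(y in B) (q0 y)%:E)%E ->
  (obs_prob n g0 [set y | (q y < 2 * a * q0 y)%R] <=
   (4 * a * expR (n%:R * `|g - g0| ^+ 2))%:E)%E.
Proof.
move=> n0 a0 qge0 q0ge0 mq mq0 qE q0E.
pose rn : R := Num.sqrt n%:R.
have rn0 : 0 < rn by rewrite sqrtr_gt0 ltr0n.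
have rnn : rn ^+ 2 = n%:R by rewrite sqr_sqrtr.
pose h := rn *: (g0 - g).
have hh : `|h| ^+ 2 = n%:R * `|g - g0| ^+ 2.
  by rewrite /h normrZ exprMn gtr0_norm// rnn distrC.
(* Density of the law under g0 relative to that under g, as a function of the data: under g, √n
   (y(h) - ⟨g,h⟩) is the noise ξ(h). *)
pose L (y : path_space R G) := expR (rn * (y h - inner g h) - `|h| ^+ 2 / 2).
have mL : measurable_fun setT L.
  apply: measurableT_comp => //; apply: measurable_funB => //.
  apply: measurable_funM => //; apply: measurable_funB => //.
  exact: measurable_coord.
pose N := [set y | (q y < 2 * a * q0 y)%R].
pose K := [set y | (L y <= (4 * a)^-1)%R].
have mN : measurable N.
  by apply: measurable_set_ltr => //; exact: measurable_funM.
have mK : measurable K by exact: measurable_set_ler.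
have mNK : measurable (N `&` K) by exact: measurableI.
have mCK : measurable (~` K) by exact: measurableC.
have obs0 o w : observation xi n g0 o w = inner g w + rn^-1 * shifted_path xi h o w.
  rewrite /observation /shifted_path /h innerZl innerBl -/rn; field.
  by rewrite gt_eqF.
(* By Cameron-Martin the g0-mass of N `&` K is at most (4a)^-1 times its g-mass,
   hence at most half of itself. *)
have NK0 : obs_prob n g0 (N `&` K) = 0%E.
  (* [aff] turns the noise path into the observation under g, and the shifted path into that under
     g0. *)
  pose aff (y : path_space R G) : path_space R G := fun w => inner g w + rn^-1 * y w.
  have maff : measurable_fun setT aff.
    apply: measurable_path => w; apply: measurable_funD => //.
    by apply: measurable_funM => //; exact: measurable_coord.
  have maB : measurable (aff @^-1` (N `&` K)).
    by rewrite -[X in measurable X]setTI; exact: maff.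
  have cm : obs_prob n g0 (N `&` K) = (\int[P]_o
      (\1_(aff @^-1` (N `&` K)) (noise_path xi o) * expR (xi h o - `|h| ^+ 2 / 2))%:E)%E.
    rewrite -cameron_martin// obs_probE; congr (P _); apply/seteqP; split => o /=;
    by rewrite (_ : observation xi n g0 o = aff (shifted_path xi h o))//; apply/funext => w.
  have le1 : (obs_prob n g0 (N `&` K) <= (4 * a)^-1%:E * obs_prob n g (N `&` K))%E.
    rewrite cm; have <- : (\int[P]_o ((4 * a)^-1%:E *
        (\1_[set o | (N `&` K) (observation xi n g o)] o)%:E) =
        (4 * a)^-1%:E * obs_prob n g (N `&` K))%E.
      have mO : measurable [set o | (N `&` K) (observation xi n g o)].
        rewrite -[X in measurable X]setTI; exact: measurable_observation.
      rewrite ge0_integralZl//; last 2 first.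
      - by apply/measurable_EFinP; exact: measurable_indic.
      - by rewrite lee_fin invr_ge0 mulr_ge0// ltW.
      by rewrite integral_indic// setIT.
    apply: ge0_le_integral => //.
    - apply/measurable_EFinP; apply: measurable_funM.
        by apply: (measurableT_comp _ (measurable_noise_path _)); exact: measurable_indic.
      by apply: measurableT_comp => //; exact: measurable_funB.
    - apply/measurable_EFinP; apply: measurable_funM => //; apply: measurable_indic.
      rewrite -[X in measurable X]setTI; exact: measurable_observation.
    - move=> o _; rewrite -EFinM lee_fin !indicE.
      rewrite (_ : noise_path xi o \in aff @^-1` (N `&` K) =
        (o \in [set o | (N `&` K) (observation xi n g o)])); last exact/idP/idP.
      case: (boolP (_ \in _)) => [|_]; last by rewrite mul0r mulr0.
      rewrite inE/= mul1r mulr1 => -[_]; rewrite /K/= /L /observation -/rn.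
      by rewrite (addrC (inner g h)) addrK mulrA divff ?mul1r// gt_eqF.
  have le2 : (obs_prob n g (N `&` K) <= (2 * a)%:E * obs_prob n g0 (N `&` K))%E.
    rewrite qE// q0E// -ge0_integralZl//; last 3 first.
    - by apply: measurable_funTS; exact/measurable_EFinP.
    - by move=> y _; rewrite lee_fin.
    - by rewrite lee_fin mulr_ge0// ltW.
    apply: ge0_le_integral => //.
    - by move=> y _; rewrite lee_fin.
    - by apply: measurable_funTS; exact/measurable_EFinP.
    - apply: measurable_funTS; apply: measurable_funeM; exact/measurable_EFinP.
    - by move=> y [Ny _]; rewrite -EFinM lee_fin ltW.
  have fin : obs_prob n g0 (N `&` K) \is a fin_num by exact: fin_num_measure.
  have : (obs_prob n g0 (N `&` K) <= (4 * a)^-1%:E * ((2 * a)%:E * obs_prob n g0 (N `&` K)))%E.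
    by apply: (le_trans le1); rewrite lee_wpmul2l// lee_fin invr_ge0 mulr_ge0// ltW.
  rewrite -(fineK fin); set x := fine _; rewrite -!EFinM lee_fin => xle.
  have x0 : 0 <= x by rewrite fine_ge0.
  have e2 : (4 * a)^-1 * (2 * a * x) = x / 2 by field; rewrite gt_eqF.
  by rewrite e2 in xle; congr EFin; lra.
have CK : (obs_prob n g0 (~` K) <= (4 * a * expR (n%:R * `|g - g0| ^+ 2))%:E)%E.
  (* Under g0 the density L equals e^{ξ(h) + ‖h‖²/2}, with mean e^{‖h‖²}. *)
  have mgf := has_integralZ (4 * a * expR (`|h| ^+ 2 / 2)) (noise_mgf xi_noise h).
  have <- : 4 * a * expR (`|h| ^+ 2 / 2) * expR (`|h| ^+ 2 / 2) =
      4 * a * expR (n%:R * `|g - g0| ^+ 2).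
    by rewrite -mulrA -expRD -hh; congr (_ * expR _); field.
  case: mgf => mgfi <-.
  have mO : measurable [set o | (~` K) (observation xi n g0 o)].
    by rewrite -[X in measurable X]setTI; exact: measurable_observation.
  rewrite obs_probE -[X in P X]setIT -integral_indic//.
  apply: ge0_le_integral => //.
  - by apply/measurable_EFinP; exact: measurable_indic.
  - exact: measurable_int mgfi.
  - move=> o _; rewrite lee_fin indicE; case: (boolP (_ \in _)) => [|_]; last first.
      by rewrite !mulr_ge0// ?expR_ge0// ltW.
    rewrite inE/= => /negP; rewrite -ltNge /L => h1.
    rewrite -mulrA -expRD.
    have -> : `|h| ^+ 2 / 2 + xi h o =
        rn * (observation xi n g0 o h - inner g h) - `|h| ^+ 2 / 2.
      rewrite obs0 /shifted_path inner_norm (addrC (inner g h)) addrK mulrA divff ?gt_eqF//.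
      by field.
    by rewrite -ler_pdivrMl ?mulr_gt0// mulr1 ltW.
rewrite (_ : [set y | _] = N)//.
apply: (@le_trans _ _ (obs_prob n g0 (N `&` K `|` ~` K))).
  apply: le_measure; rewrite ?inE//; first exact: measurableU.
  by move=> y Ny; have [Ky|nK] := pselect (K y); [left|right].
apply: le_trans (measureU2 _ mNK mCK) _; rewrite -[leRHS]add0e.
by apply: leeD; [rewrite -[leRHS]NK0|exact: CK].
Qed.

(** * A chi-square test on the projected data *)

Section galerkin_test.
Variables (E : hilbertType R) (A : {linear E -> G}) (k : nat) (u : nat -> E).
Hypothesis ou : orthonormal_image A k u.

(** The sum is the squared distance between the projections of the data and of [g0] on the span of
    the A u_i; [r] is a squared radius. *)
Definition accept_region (g0 : G) (r : R) : set (path_space R G) :=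
  [set y | \sum_(i < k) (y (A (u i)) - inner g0 (A (u i))) ^+ 2 <= r].

Lemma measurable_accept_region g0 r : measurable (accept_region g0 r).
Proof.
apply: measurable_set_ler => //.
apply: measurable_sum => i; apply: measurable_funX; apply: measurable_funB => //.
exact: measurable_coord.
Qed.

Lemma observation_sum_sqr n g0 o : (0 < n)%N ->
  \sum_(i < k) (observation xi n g0 o (A (u i)) - inner g0 (A (u i))) ^+ 2 =
  n%:R^-1 * \sum_(i < k) xi (A (u i)) o ^+ 2.
Proof.
move=> n0; rewrite mulr_sumr; apply: eq_bigr => i _.
by rewrite /observation (addrC (inner _ _)) addrK exprMn exprVn sqr_sqrtr.
Qed.

Let chi_tail (s : R) := noise_chi_square_tail xi_noise s
  (e := fun i => A (u i)) (k := k) (fun i l ik lk => ou ik lk).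

Lemma test_type1 n g0 (s : R) : (0 < n)%N ->
  (obs_prob n g0 (~` accept_region g0 (4 * s / n%:R)) <= (expR (k%:R - s))%:E)%E.
Proof.
move=> n0; apply: le_trans (chi_tail s).
rewrite obs_probE le_eqVlt; apply/orP; left; apply/eqP; congr (P _).
apply/seteqP; split => o; rewrite /accept_region/= observation_sum_sqr// ler_pdivrMl ?ltr0n//.
  by move/negP; rewrite -ltNge mulrCA divff ?mulr1// pnatr_eq0 -lt0n.
by move=> h; apply/negP; rewrite -ltNge mulrCA divff ?mulr1// pnatr_eq0 -lt0n.
Qed.

(** By (b - c)² <= 2 (x - b)² + 2 (x - c)², acceptance together with a chi-square sum of at most 4s
    would put the projections within squared distance 4 (4s/n). Acceptance thus forces a chi-square
    deviation. *)
Lemma test_type2 n (f f0 : E) (s : R) : (0 < n)%N ->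
  4 * (4 * s / n%:R) < `|A (projection_coord A k u (A f) - projection_coord A k u (A f0))| ^+ 2 ->
  (obs_prob n (A f) (accept_region (A f0) (4 * s / n%:R)) <= (expR (k%:R - s))%:E)%E.
Proof.
move=> n0; rewrite -projection_coordB norm_projection// => far.
apply: le_trans (chi_tail s); rewrite obs_probE; apply: le_measure.
- rewrite inE -[X in measurable X]setTI.
  apply: (measurable_observation n (A f) measurableT).
  exact: measurable_accept_region.
- rewrite inE; apply: measurable_set_ltr => //.
  by apply: measurable_sum => i; exact: measurable_funX.
move=> o /= acc; rewrite ltNge; apply/negP => small.
have : n%:R^-1 * \sum_(i < k) xi (A (u i)) o ^+ 2 <= 4 * s / n%:R.
  by rewrite mulrC ler_wpM2r// invr_ge0.
rewrite -(observation_sum_sqr (A f))// => small'.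
have : \sum_(i < k) inner (A f - A f0) (A (u i)) ^+ 2 <=
    2 * \sum_(i < k) (observation xi n (A f) o (A (u i)) - inner (A f0) (A (u i))) ^+ 2 +
    2 * \sum_(i < k) (observation xi n (A f) o (A (u i)) - inner (A f) (A (u i))) ^+ 2.
  rewrite !mulr_sumr -big_split/=; apply: ler_sum => i _; rewrite innerBl.
  set x := observation _ _ _ _ _; set b := inner _ _; set c := inner _ _.
  have := sqr_ge0 (x - b + (x - c)); nra.
by move: acc; rewrite /accept_region/=; lra.
Qed.

End galerkin_test.

End observation_law.

(** * Borel measurability and the contraction theorem *)

Lemma continuous_bounded_linear {R : realType} {E F : normedModType R}
    (A : {linear E -> F}) :
  (exists C : R, forall x, `|A x| <= C * `|x|) -> continuous A.
Proof.
move=> [C CP] x; apply/cvgrPdist_le => e e0.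
have C1 : 0 < `|C| + 1 by rewrite ltr_wpDl.
near=> z; rewrite -linearB (le_trans (CP _))//.
rewrite (@le_trans _ _ (`|x - z| * (`|C| + 1)))//.
  by rewrite mulrC ler_wpM2l// (le_trans (ler_norm _))// lerDl.
rewrite -ler_pdivlMr//; near: z.
by apply: cvgr_dist_le => //; rewrite divr_gt0.
Unshelve. all: by end_near. Qed.

Lemma measurable_norm_gt {R : realType} {E F : normedModType R} (g : E -> F) (r : R) :
  continuous g -> measurable ([set x | r < `|g x|] : set (borel E)).
Proof.
move=> cg; apply: sub_sigma_algebra.
apply: (@open_comp _ _ (fun x => `|g x|) [set t | r < t]); last exact: open_gt.
by move=> x _; apply: cvg_norm; exact: cg.
Qed.

Lemma measurable_norm_lt {R : realType} {E F : normedModType R} (g : E -> F) (r : R) :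
  continuous g -> measurable ([set x | `|g x| < r] : set (borel E)).
Proof.
move=> cg; apply: sub_sigma_algebra.
apply: (@open_comp _ _ (fun x => `|g x|) [set t | t < r]); last exact: open_lt.
by move=> x _; apply: cvg_norm; exact: cg.
Qed.

Lemma continuous_projection_coord {R : realType} {E G : hilbertType R}
    (A : {linear E -> G}) k (u : nat -> E) :
  continuous A -> continuous (fun f => projection_coord A k u (A f)).
Proof.
move=> cA x; rewrite /projection_coord; elim: k => [|k IH].
  by under eq_fun do rewrite big_ord0; exact: cvg_cst.
under eq_fun do rewrite big_ord_recr/=.
apply: cvgD; first exact: IH.
apply: cvgZ; last exact: cvg_cst.
apply: (cvg_comp A (fun z => inner z (A (u k)))); first exact: cA.
exact: continuous_innerl.
Qed.

Theorem theorem3p1 (R : realType)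
  (H : smoothness_scale R)
  (S : R) (S_gt0 : 0 < S)
  (V : nat -> set (H 0)) (delta : nat -> R -> R)
  (approx : approximation_assumption S V delta)
  (G : hilbertType R) (G_separable : separable G)
  (A : {linear H 0 -> G})
  (A_bounded : exists C : R, forall f : H 0, `|A f| <= C * `|f|)
  (gamma : R) (gamma_gt0 : 0 < gamma) (gamma_ltS : gamma < S)
  (A_smoothing : exists c1 c2 : R, [/\ 0 < c1, 0 < c2 &
    forall f : H 0,
      c1 * `|scale_incl (- gamma) f| <= `|A f| <= c2 * `|scale_incl (- gamma) f|])
  (beta : R) (beta_gt0 : 0 < beta) (beta_ltS : beta < S)
  (f0 : H 0) (f0_smooth : exists g : H beta, scale_incl 0 g = f0)
  (eps eta : nat -> R)
  (eps_le_eta : forall n, (0 < n)%N -> eps n <= eta n)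
  (eps_noninc : forall m n, (0 < m)%N -> (m <= n)%N -> eps n <= eps m)
  (eps_cvg0 : eps n @[n --> \oo] --> 0)
  (neps2_cvg : n%:R * eps n ^+ 2 @[n --> \oo] --> +oo)
  (j : nat -> nat)
  (j_gt0 : forall n, (0 < n)%N -> (0 < j n)%N)
  (j_cvg : j n @[n --> \oo] --> \oo)
  (c : R) (c_gt0 : 0 < c)
  (j_le : forall n, (0 < n)%N -> (j n)%:R <= c * (n%:R * eps n ^+ 2))
  (eta_ge1 : forall n, (0 < n)%N -> eps n / delta (j n) gamma <= eta n)
  (eta_ge2 : forall n, (0 < n)%N -> delta (j n) beta <= eta n)
  (Pi : nat -> probability (borel (H 0)) R)
  (prior_mass : forall n, (0 < n)%N ->
    ((expR (- (n%:R * eps n ^+ 2))%R)%:E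
       <= Pi n [set f : H 0%R | (`|A f - A f0| < eps n)%R])%E)
  (prior_galerkin : forall n, (0 < n)%N ->
    (Pi n [set f : H 0%R | (eta n < `|galerkin A (V (j n)) f - f|)%R]
       <= (expR (- (4 * (n%:R * eps n ^+ 2)))%R)%:E)%E)
  (d : measure_display) (Omega : measurableType d) (P : probability Omega R)
  (xi : G -> {RV P >-> R}) (xi_noise : white_noise xi)
  (p : nat -> H 0 -> (G -> R) -> R)
  (p_density : forall n, (0 < n)%N -> is_likelihood A xi n (p n)) :
  exists M0 : R, forall M : R, M0 <= M ->
  forall e : R, 0 < e ->
    obs_law A xi n f0
      [set y | (e%:E < posterior (Pi n) (p n) y
                         [set f : H 0%R | (M * eta n < `|f - f0|)%R])%E]
    @[n --> \oo] --> 0%E.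
Proof.
have [C1 C10 stab] := galerkin_stability approx gamma_gt0 gamma_ltS A_smoothing.
have [C2 C20 err] := galerkin_error approx gamma_gt0 gamma_ltS A_smoothing
  beta_gt0 beta_ltS f0_smooth.
have cA := continuous_bounded_linear A_bounded.
(* K ε_n² is the squared radius of the test. With k <= c s degrees of freedom, the factor c + 4
   brings the tail bounds e^{k - (c+4)s} down to e^{-4s}. *)
pose K := 4 * (c + 4).
have K0 : 0 < K by rewrite mulr_gt0// addr_gt0.
pose rK := Num.sqrt K.
have rK0 : 0 < rK by rewrite sqrtr_gt0.
have rK2 : rK ^+ 2 = K by rewrite sqr_sqrtr// ltW.
(* The three terms: Galerkin error of f, distance between the Galerkin solutions of f and f0 left
   open by the test, Galerkin error of f0. *)
exists (1 + C1 * (2 * rK) + C2) => M MM e e0.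
pose s (n : nat) : R := n%:R * eps n ^+ 2.
have key n : (0 < n)%N -> (obs_law A xi n f0
      [set y | (e%:E < posterior (Pi n) (p n) y
                         [set f : H 0%R | (M * eta n < `|f - f0|)%R])%E] <=
      ((9 + 4 / e) * expR (- s n))%:E)%E.
  move=> n0; have nr0 : 0 < n%:R :> R by rewrite ltr0n.
  have [p0 mp pE] := p_density n n0.
  have jn := j_gt0 n n0.
  have [u ou [Vu galE]] := galerkin_basis approx gamma_gt0 gamma_ltS A_smoothing jn.
  set k := (j n).-1 in ou Vu galE.
  have [_ /(_ _ gamma_gt0 gamma_ltS)[dpos _ _ _]] := approx.
  have dj := dpos _ jn.
  have [_ /(_ _ beta_gt0 beta_ltS)[bpos _ _ _]] := approx.
  have bj := bpos _ jn.
  have eta0 : 0 < eta n by rewrite (lt_le_trans bj)// eta_ge2.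
  have eps0 : 0 <= eps n.
    apply: (cvgr_to_le eps_cvg0); exists n => // m /= nm; exact: eps_noninc.
  have s0 : 0 <= s n by rewrite mulr_ge0// sqr_ge0.
  have ks : k%:R <= c * s n.
    by apply: le_trans (j_le n n0); rewrite ler_nat /k leq_pred.
  have cgal : continuous (fun f => galerkin A (V (j n)) f - f).
    rewrite (_ : (fun f => _) = (fun f => projection_coord A k u (A f) - f)).
      by move=> f; apply: cvgB; [exact: continuous_projection_coord|exact: cvg_id].
    by apply/funext => f; rewrite galE.
  have csub (E : normedModType R) (g : E) : continuous (fun f : E => f - g).
    by move=> f; apply: cvgB; [exact: cvg_id|exact: cvg_cst].
  pose B : set (borel (H 0)) := [set f : H 0 | M * eta n < `|f - f0|].
  pose B0 : set (borel (H 0)) := [set f : H 0 | `|A f - A f0| < eps n].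
  pose B1 : set (borel (H 0)) := [set f : H 0 | eta n < `|galerkin A (V (j n)) f - f|].
  have mB : measurable B by exact: (measurable_norm_gt (g := fun f : H 0 => f - f0)).
  have mB0 : measurable B0.
    apply: (measurable_norm_lt (g := fun f : H 0 => A f - A f0)) => f.
    by apply: cvgB; [exact: cA|exact: cvg_cst].
  have mB1 : measurable B1 by exact: measurable_norm_gt.
  pose Psi := accept_region A k u (A f0) (4 * ((c + 4) * s n) / n%:R).
  have tail : expR (k%:R - (c + 4) * s n) <= expR (- (4 * s n)).
    by rewrite ler_expR; nra.
  (* The part of [B] with small Galerkin error is the one left to the test. *)
  apply: (@posterior_tail_bound R _ _ (borel (H 0)) (path_space R G)
    (obs_prob xi n (A 0)) (fun f => obs_prob xi n (A f)) (p n) (Pi n) p0 mp pE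
    B B0 B1 (~` B1 `&` B) Psi f0 (s n) e) => //.
  - by apply: measurableI => //; exact: measurableC.
  - exact: measurable_accept_region.
  - by move=> f Bf; have [B1f|nB1] := pselect (B1 f); [left|right].
  - exact: prior_mass.
  - move=> f B0f.
    have mpf g : measurable_fun setT (p n g : path_space R G -> R).
      exact: (measurableT_comp mp (@measurable_pair1 _ _ (borel (H 0)) (path_space R G) g)).
    apply: le_trans (@likelihood_ratio_bound _ _ _ _ _ _ xi_noise n (A f) (A f0)
      (obs_prob xi n (A 0)) (p n f) (p n f0) _ n0 (expR_gt0 (- (2 * s n)))
      (p0 f) (p0 f0) (mpf f) (mpf f0) (pE f) (pE f0)) _.
    (* With a = e^{-2s}, the bound 4a e^{n‖A f - A f0‖²} is at most 4 e^{-s} on the prior ball. *)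
    rewrite lee_fin -mulrA ler_wpM2l// -expRD ler_expR.
    suff : n%:R * `|A f - A f0| ^+ 2 <= s n by lra.
    rewrite ler_wpM2l// ler_pXn2r ?nnegrE//; exact: ltW.
  - exact: prior_galerkin.
  - by apply: le_trans (test_type1 xi_noise ou (A f0) _ n0) _; rewrite lee_fin.
  - move=> f [/negP]; rewrite -leNgt => near_gal far.
    apply: (@le_trans _ _ (expR (k%:R - (c + 4) * s n))%:E); last by rewrite lee_fin.
    (* If the images of the two Galerkin solutions were close, f would lie within M η_n of f0,
       contrary to [far]. *)
    apply: (test_type2 xi_noise ou) => //; rewrite ltNge; apply/negP => Asmall.
    set pf := projection_coord A k u (A f) in Asmall.
    set pf0 := projection_coord A k u (A f0) in Asmall.
    (* The factor 2 is the square root of the leading 4 in the separation required by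
       [test_type2]. *)
    have A1 : `|A (pf - pf0)| <= 2 * rK * eps n.
      rewrite -(@ler_pXn2r _ 2)// ?nnegrE//; last by rewrite !mulr_ge0// ltW.
      apply: (le_trans Asmall); rewrite !exprMn rK2 /K /s le_eqVlt; apply/orP; left.
      by apply/eqP; field; rewrite gt_eqF.
    have pp : `|pf - pf0| <= C1 * (2 * rK) * eta n.
      apply: (le_trans (stab (j n) _ jn _)).
        by rewrite Vu /pf /pf0 -projection_coordB; exact: span_projection_coord.
      rewrite -[leRHS]mulrA ler_wpM2l ?(ltW C10)//.
      apply: (@le_trans _ _ (2 * rK * (eps n / delta (j n) gamma))).
        by rewrite mulrA [leRHS]mulrC ler_wpM2l// invr_ge0 ltW.
      by rewrite ler_wpM2l ?eta_ge1// mulr_ge0// ltW.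
    have q1 : `|f - pf| <= eta n by rewrite distrC /pf -galE.
    have q2 : `|pf0 - f0| <= C2 * eta n.
      rewrite /pf0 -galE (le_trans (err _ jn))// ler_wpM2l ?(ltW C20)//.
      exact: eta_ge2.
    have : `|f - f0| <= M * eta n.
      have -> : f - f0 = (f - pf) + ((pf - pf0) + (pf0 - f0)).
        by rewrite !addrA !subrK.
      apply: (@le_trans _ _ (eta n + (C1 * (2 * rK) * eta n + C2 * eta n))).
        rewrite (le_trans (ler_normD _ _))// lerD//.
        by rewrite (le_trans (ler_normD _ _))// lerD.
      apply: le_trans (ler_wpM2r (ltW eta0) MM).
      by rewrite le_eqVlt; apply/orP; left; apply/eqP; ring.
    by move: far; rewrite /B/= => /lt_le_trans h /h; rewrite ltxx.
have lim0 : ((9 + 4 / e) * expR (- s n))%:E @[n --> \oo] --> 0%E.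
  apply/fine_cvgP; split; first exact: nearW.
  rewrite -[X in _ --> X](mulr0 (9 + 4 / e)).
  apply: cvgM; first exact: cvg_cst.
  exact: (cvg_comp s (fun x : R => expR (- x)) neps2_cvg (@cvgr_expR R)).
apply: squeeze_cvge lim0; last first; first exact: cvg_cst.
exists 1%N => // n /= n0; rewrite key// andbT.
exact: (measure_ge0 P _).
Qed.
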